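(* Let $k\ge1$ and let $f:D\to\Lambda\times\mathbb{R}^u\times\mathbb{R}^s$ be a $C^{k+1}$ map satisfying the covering conditions, the rate conditions of order $k$ and the backward cone conditions (so that for each $z\in W^{cs}$ the stable fiber $W^s_z$ is the graph $\{(w^s_z(y),y):y\in\overline B_s(R)\}$ of a function $w^s_z:\overline B_s(R)\to\Lambda\times\overline B_u(R)$). Let $M\in(0,1/L)$ and $\mu=\sup_{z\in D}\{\|\partial f_y/\partial y(z)\|+M\|\partial f_y/\partial(\lambda,x)(z)\|\}$, $\xi=\inf_{z\in D}m([\partial f_{(\lambda,x)}/\partial(\lambda,x)(P(z))])-\frac1M\sup_{z\in D}\|\partial f_{(\lambda,x)}/\partial y(z)\|$. If $\xi/\mu>1$, then for every $z\in W^{cs}$ the function $w^s_z$ is Lipschitz with constant $M$.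
   Context: Setting. $c,u,s$ positive integers, $\Lambda=(\mathbb{R}/\mathbb{Z})^c$, $R_\Lambda=\tfrac12$. Points of $\Lambda$ are ''in the same chart'' if they have lifts to $\mathbb{R}^c$ at distance $\le R_\Lambda$; differences, norms, cones and derivatives are computed in such lifted coordinates; $\overline B_c(\lambda,R_\Lambda)$ is the closed ball of radius $R_\Lambda$ about a lift of $\lambda$. $B_n(R),\overline B_n(R)$: open/closed balls of radius $R$ at $0$ in $\mathbb{R}^n$; Euclidean norms. Fix $0<R<R_\Lambda/2$, $D=\Lambda\times\overline B_u(R)\times\overline B_s(R)$, points $z=(\lambda,x,y)$ with projections $\pi_\lambda,\pi_x,\pi_y,\pi_{(\lambda,x)},\pi_{(\lambda,y)}$; $f=(f_\lambda,f_x,f_y)$. $m(A)=\max\{c:\|Av\|\ge c\|v\|\ \forall v\}$, $m(\mathbf A)=\inf_{A\in\mathbf A}m(A)$ for a set of matrices; $[\partial g/\partial w(U)]$ is the set of matrices whose $(i,j)$ entry lies in $[\inf_U\partial g_i/\partial w_j,\sup_U\partial g_i/\partial w_j]$. $P(z)=\{w\in D:\|\pi_\lambda w-\pi_\lambda z\|\le R_\Lambda/2\}$. Fix $L\in(2R/R_\Lambda,1)$ and define $\mu_{s,1}=\sup_{D}\{\|\partial_y f_y\|+\frac1L\|\partial_{(\lambda,x)}f_y\|\}$, $\mu_{s,2}=\sup_D\{\|\partial_yf_y\|+L\|\partial_yf_{(\lambda,x)}\|\}$, $\xi_{u,1}=\inf_D\{m(\partial_xf_x)-\frac1L\|\partial_{(\lambda,y)}f_x\|\}$,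 $\xi_{u,1,P}=\inf_{z\in D}m[\partial_xf_x(P(z))]-\frac1L\sup_D\|\partial_{(\lambda,y)}f_x\|$, $\xi_{u,2}=\inf_D\{m(\partial_xf_x)-L\|\partial_xf_{(\lambda,y)}\|\}$, $\mu_{cs,1}=\sup_D\{\|\partial_{(\lambda,y)}f_{(\lambda,y)}\|+L\|\partial_xf_{(\lambda,y)}\|\}$, $\mu_{cs,2}=\sup_D\{\|\partial_{(\lambda,y)}f_{(\lambda,y)}\|+\frac1L\|\partial_{(\lambda,y)}f_x\|\}$, $\xi_{cu,1}=\inf_D\{m(\partial_{(\lambda,x)}f_{(\lambda,x)})-L\|\partial_yf_{(\lambda,x)}\|\}$, $\xi_{cu,1,P}=\inf_{z\in D}m[\partial_{(\lambda,x)}f_{(\lambda,x)}(P(z))]-L\sup_D\|\partial_yf_{(\lambda,x)}\|$, $\xi_{cu,2}=\inf_D\{m(\partial_{(\lambda,x)}f_{(\lambda,x)})-\frac1L\|\partial_{(\lambda,x)}f_y\|\}$. Rate conditions of order $k$: all $\xi$'s above positive, $\mu_{s,1}<1<\xi_{u,1,P}$, $\mu_{cs,1}<\xi_{u,1,P}$, $\mu_{s,1}<\xi_{cu,1,P}$, and for $1\le j\le k$: $\mu_{cs,1}^{j+1}<\xi_{u,2}$, $\mu_{s,2}<\xi_{cu,1}^{j+1}$; and $\mu_{cs,2}<\xi_{u,1}$, $\mu_{s,1}<\xi_{cu,2}$. Cones: $J_s(z,M)=\{\|(\lambda,x)-\pi_{(\lambda,x)}z\|\le M\|y-\pi_yz\|\}$,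 $J_u(z,M)=\{\|(\lambda,y)-\pi_{(\lambda,y)}z\|\le M\|x-\pi_xz\|\}$. $W^{cs}=\{z:f^n(z)\in D\ \forall n\ge0\}$; for $z\in W^{cs}$, $W^s_z=\{p\in D:f^n(p)\in J_s(f^n(z),1/L)\cap D\ \forall n\ge0\}$. Backward cone conditions: if $z_1,z_2,f(z_1),f(z_2)\in D$ and $f(z_1)\in J_s(f(z_2),1/L)$ then $z_1\in J_s(z_2,1/L)$. Covering conditions: with $D_\lambda=\overline B_c(\lambda,R_\Lambda)\times\overline B_u(R)\times\overline B_s(R)$, $D^+_\lambda=\overline B_c(\lambda,R_\Lambda)\times\overline B_u(R)\times\partial B_s(R)$, $D^-_\lambda=\overline B_c(\lambda,R_\Lambda)\times\partial B_u(R)\times B_s(R)$: for every $z\in D$ there exist $\lambda^*$, a homotopy $h:[0,1]\times U\to B_c(\lambda^*,R_\Lambda)\times\mathbb{R}^u\times\mathbb{R}^s$, $U=J_u(z,1/L)\cap D$, and linear $A$ on $\mathbb{R}^u$ with $h_0=f|_U$, $h_\alpha(U\cap D^-_{\pi_\lambda z})\cap D_{\lambda^*}=\emptyset$, $h_\alpha(U)\cap D^+_{\lambda^*}=\emptyset$ for all $\alpha$, $h_1(\lambda,x,y)=(\lambda^*,Ax,0)$, $A(\partial B_u(R))\subset\mathbb{R}^u\setminus\overline B_u(R)$. *)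

(* Defs.v *)
From HB Require Import structures.
From mathcomp Require Import all_boot all_order all_algebra.
From mathcomp Require Import all_classical all_reals all_analysis.
Set Implicit Arguments. Unset Strict Implicit. Unset Printing Implicit Defensive.
Import Order.TTheory GRing.Theory Num.Theory.
Import numFieldNormedType.Exports.
Local Open Scope classical_set_scope.
Local Open Scope ring_scope.

(* Conventions.  A point z = (lambda, x, y) of Lambda x R^u x R^s, with      *)
(* Lambda = (R/Z)^c, is represented by a lift: a column vector of            *)
(* 'cV[R]_(c+u+s) whose coordinates 0..c-1 are lambda (a lift to R^c),       *)
(* c..c+u-1 are x and c+u..c+u+s-1 are y.  The map f is represented by a     *)
(* lift F : R^(c+u+s) -> R^(c+u+s) (see [is_lift]).           *)

Definition enorm (R : realType) (m : nat) (v : 'cV[R]_m) : R :=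
  Num.sqrt (\sum_(i < m) v i ord0 ^+ 2).

Section Defs.
Variable R : realType.
Variables c u s : nat.
Local Notation N := (c + u + s)%N.
Local Notation V := 'cV[R]_N.
Local Notation M := 'M[R]_N.

Definition RL : R := 2^-1.

Definition isL : pred 'I_N := fun i => (i < c)%N.
Definition isX : pred 'I_N := fun i => (c <= i < c + u)%N.
Definition isY : pred 'I_N := fun i => (c + u <= i)%N.
Definition isLX : pred 'I_N := fun i => (i < c + u)%N.
Definition isLY : pred 'I_N := fun i => isL i || isY i.

Definition cproj (P : pred 'I_N) (v : V) : V :=
  \col_i (if P i then v i ord0 else 0).

Definition xof (v : V) : 'cV[R]_u := \col_(i < u) v (lshift s (rshift c i)) ord0.
Definition embX (x : 'cV[R]_u) : V :=
  \sum_(i < u) x i ord0 *: delta_mx (lshift s (rshift c i)) ord0.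

(* lifts of 0 : the integer translations Z^c x {0} x {0} *)
Definition shifts : set V :=
  [set m : V | forall i : 'I_N,
     if isL i then is_true (m i ord0 \is a Num.int) else m i ord0 = 0].

(* norm of the P-components of a difference v, with the lambda-difference
   computed in a chart, i.e. for the closest lift *)
Definition tdist (P : pred 'I_N) (v : V) : R :=
  inf [set enorm (cproj P (v + m)) | m in shifts].

Definition Dom (R0 : R) : set V :=
  [set p | enorm (cproj isX p) <= R0 /\ enorm (cproj isY p) <= R0].

Definition Pset (R0 : R) (z : V) : set V :=
  [set w | Dom R0 w /\ tdist isL (w - z) <= RL / 2].

Fixpoint iterD (ds : seq 'I_N) (F : V -> V) : V -> V :=
  match ds with
  | [::] => F
  | j :: ds' => fun p => derive (iterD ds' F) p (delta_mx j ord0)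
  end.

Definition Ck (k : nat) (U : set V) (F : V -> V) : Prop :=
  forall ds : seq 'I_N, (size ds <= k)%N ->
    (forall p, U p -> {for p, continuous (iterD ds F)}) /\
    ((size ds < k)%N -> forall j p, U p -> derivable (iterD ds F) p (delta_mx j ord0)).

Definition is_lift (R0 : R) (F : V -> V) : Prop :=
  forall p m, Dom R0 p -> shifts m -> shifts (F (p + m) - F p).

Definition Jac (F : V -> V) (p : V) : M :=
  \matrix_(i, j) derive F p (delta_mx j ord0) i ord0.

Definition bnorm (I J : pred 'I_N) (A : M) : R :=
  sup [set enorm (cproj I (A *m v)) | v in [set v | cproj J v = v /\ enorm v <= 1]].
(* m(A) = max{c : |Av| >= c|v|} for the block d g_I / d w_J of A *)
Definition bm (I J : pred 'I_N) (A : M) : R :=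
  inf [set enorm (cproj I (A *m v)) | v in [set v | cproj J v = v /\ enorm v = 1]].
(* m([d g_I / d w_J (U)]) for the interval matrix over the set U *)
Definition bmI (F : V -> V) (I J : pred 'I_N) (U : set V) : R :=
  inf [set bm I J A | A in
        [set A : M | forall i j, I i -> J j ->
           inf [set Jac F w i j | w in U] <= A i j <= sup [set Jac F w i j | w in U]]].

Definition supD (R0 : R) (g : V -> R) : R := sup [set g p | p in Dom R0].
Definition infD (R0 : R) (g : V -> R) : R := inf [set g p | p in Dom R0].

Section Rates.
Variables (R0 L : R) (F : V -> V).
Local Notation J := (Jac F).
Definition mu_s1 := supD R0 (fun p => bnorm isY isY (J p) + L^-1 * bnorm isY isLX (J p)).
Definition mu_s2 := supD R0 (fun p => bnorm isY isY (J p) + L * bnorm isLX isY (J p)).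
Definition xi_u1 := infD R0 (fun p => bm isX isX (J p) - L^-1 * bnorm isX isLY (J p)).
Definition xi_u1P := infD R0 (fun z => bmI F isX isX (Pset R0 z))
                     - L^-1 * supD R0 (fun p => bnorm isX isLY (J p)).
Definition xi_u2 := infD R0 (fun p => bm isX isX (J p) - L * bnorm isLY isX (J p)).
Definition mu_cs1 := supD R0 (fun p => bnorm isLY isLY (J p) + L * bnorm isLY isX (J p)).
Definition mu_cs2 := supD R0 (fun p => bnorm isLY isLY (J p) + L^-1 * bnorm isX isLY (J p)).
Definition xi_cu1 := infD R0 (fun p => bm isLX isLX (J p) - L * bnorm isLX isY (J p)).
Definition xi_cu1P := infD R0 (fun z => bmI F isLX isLX (Pset R0 z))
                     - L * supD R0 (fun p => bnorm isLX isY (J p)).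
Definition xi_cu2 := infD R0 (fun p => bm isLX isLX (J p) - L^-1 * bnorm isY isLX (J p)).
End Rates.

Definition rate_conditions (k : nat) (R0 L : R) (F : V -> V) : Prop :=
  (0 < xi_u1 R0 L F /\ 0 < xi_u1P R0 L F /\ 0 < xi_u2 R0 L F /\
   0 < xi_cu1 R0 L F /\ 0 < xi_cu1P R0 L F /\ 0 < xi_cu2 R0 L F) /\
  (mu_s1 R0 L F < 1 /\ 1 < xi_u1P R0 L F /\
   mu_cs1 R0 L F < xi_u1P R0 L F /\ mu_s1 R0 L F < xi_cu1P R0 L F) /\
  (forall j : nat, (1 <= j <= k)%N ->
     mu_cs1 R0 L F ^+ j.+1 < xi_u2 R0 L F /\ mu_s2 R0 L F < xi_cu1 R0 L F ^+ j.+1) /\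
  (mu_cs2 R0 L F < xi_u1 R0 L F /\ mu_s1 R0 L F < xi_cu2 R0 L F).

Definition Js (z : V) (M0 : R) : set V :=
  [set p | tdist isLX (p - z) <= M0 * enorm (cproj isY (p - z))].
(* J_u(z, M0), in the chart of the given lift z (plain lifted differences) *)
Definition Ju_chart (z : V) (M0 : R) : set V :=
  [set p | enorm (cproj isLY (p - z)) <= M0 * enorm (cproj isX (p - z))].

Definition Wcs (R0 : R) (F : V -> V) : set V :=
  [set z | forall n : nat, Dom R0 (iter n F z)].
Definition Ws (R0 L : R) (F : V -> V) (z : V) : set V :=
  [set p | Dom R0 p /\ forall n : nat,
     Js (iter n F z) L^-1 (iter n F p) /\ Dom R0 (iter n F p)].

Definition backward_cone_conditions (R0 L : R) (F : V -> V) : Prop :=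
  forall z1 z2, Dom R0 z1 -> Dom R0 z2 -> Dom R0 (F z1) -> Dom R0 (F z2) ->
    Js (F z2) L^-1 (F z1) -> Js z2 L^-1 z1.

Definition covering_conditions (R0 L : R) (F : V -> V) : Prop :=
  forall z, Dom R0 z ->
  exists (lstar : V) (h : R * V -> V) (A : 'M[R]_u),
    let U := [set p | Dom R0 p /\ Ju_chart z L^-1 p] in
    let inDl (l q : V) := [/\ enorm (cproj isL (q - l)) <= RL,
                              enorm (cproj isX q) <= R0 & enorm (cproj isY q) <= R0] in
    (cproj isL lstar = lstar /\
        {within [set q : R * V | 0 <= q.1 <= 1 /\ U q.2], continuous h} /\
        (forall a p, 0 <= a <= 1 -> U p -> enorm (cproj isL (h (a, p) - lstar)) < RL) /\
        (forall p, U p -> shifts (h (0, p) - F p)) /\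
        (forall a p, 0 <= a <= 1 -> U p ->
           enorm (cproj isL (p - z)) <= RL -> enorm (cproj isX p) = R0 ->
           enorm (cproj isY p) < R0 -> ~ inDl lstar (h (a, p))) /\
        (forall a p, 0 <= a <= 1 -> U p ->
           ~ (inDl lstar (h (a, p)) /\ enorm (cproj isY (h (a, p))) = R0)) /\
        (forall p, U p -> h (1, p) = lstar + embX (A *m xof p)) /\
        (forall x : 'cV[R]_u, enorm x = R0 -> R0 < enorm (A *m x))).

End Defs.

Arguments RL {R}.
Arguments isL {c u s}. Arguments isX {c u s}. Arguments isY {c u s}.
Arguments isLX {c u s}. Arguments isLY {c u s}.
Arguments cproj {R c u s}. Arguments xof {R c u s}. Arguments embX {R c u s}.
Arguments shifts {R c u s}. Arguments tdist {R c u s}. Arguments Dom {R c u s}.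
Arguments Pset {R c u s}. Arguments Ck {R c u s}. Arguments is_lift {R c u s}.
Arguments Jac {R c u s}. Arguments bnorm {R c u s}. Arguments bm {R c u s}.
Arguments bmI {R c u s}. Arguments supD {R c u s}. Arguments infD {R c u s}.
Arguments rate_conditions {R c u s}. Arguments Js {R c u s}.
Arguments Ju_chart {R c u s}. Arguments Wcs {R c u s}. Arguments Ws {R c u s}.
Arguments backward_cone_conditions {R c u s}.
Arguments covering_conditions {R c u s}.

(* Main.v *)
(* For two points of a fiber, let e_n be the (lambda, x)-distance on the torus and
   y_n the y-distance of their n-th iterates.  Both decay like mu_{s,1}^n, and
   since mu_{s,1} < xi_{cu,1,P} the backward cone condition forces
   e_n <= y_n / L for all n.  The mean value theorem gives
   y_{n+1} <= a y_n + b e_n and e_{n+1} >= m e_n - b' y_n; if y_0 < e_0 / M, the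
   assumption mu < xi makes the slope y_n / e_n decrease by a fixed amount at each
   step, contradicting y_n / e_n >= L.  The lower bound on e_{n+1} holds for
   lifts only, so one has to know that the closest lifts of the differences are
   mapped to closest lifts: this follows from the backward cone condition by a
   continuation argument, in which the covering condition keeps the path in D. *)
Require Import Defs.
From HB Require Import structures.
From mathcomp Require Import all_boot all_order all_algebra.
From mathcomp Require Import ring lra.
From mathcomp Require Import all_classical all_reals all_analysis.
Import Order.TTheory GRing.Theory Num.Theory.
Import numFieldNormedType.Exports.
Local Open Scope classical_set_scope.
Local Open Scope ring_scope.
Set Implicit Arguments.
Unset Strict Implicit.
Unset Printing Implicit Defensive.

(** The last two steps are ordered so as to avoid a circle. The continuation argument uses the cone
    bound at two consecutive times. Hence the cone bound is proved first, with expansion used only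
    at late times, where differences are so small that a Lipschitz bound alone keeps images of
    closest lifts closest. The slope argument starts at time 0, where differences may be of the size
    of D, and there the global argument on lifts is unavoidable.

    In lifted coordinates D is not compact, and the supremum of an unbounded set of reals is 0 by
    convention. So the Jacobian has to be bounded on D, through periodicity, before a supremum over
    D can serve as an estimate.

    In the y-estimate a and b are norms at one common point, so a + k b is at most the supremum of
    the sum for every weight k. The weights 1/L and M belong to the ends L and 1/M of the range of
    slopes: mu_{s,1} < xi_{cu,1,P} and mu < xi say that the slope decreases at either end. *)

Lemma lipschitz_continuous (R : realType) (V W : normedModType R) (k : R)
    (f : V -> W) : (forall v w, `|f v - f w| <= k * `|v - w|) -> continuous f.
Proof.
move=> fk v; apply/cvgrPdist_le => e e0; near=> w.
have vw : `|v - w| <= e / (`|k| + 1).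
  by near: w; apply: cvgr_dist_le; [exact: cvg_id|rewrite divr_gt0// ltr_wpDl].
rewrite ler_pdivlMr ?ltr_wpDl// mulrC in vw.
rewrite (le_trans (fk _ _))// (le_trans _ vw)// ler_wpM2r//.
by rewrite (le_trans (ler_norm _))// lerDl.
Unshelve. all: by end_near. Qed.

Section ContinuousAt.
Variables (R : realType) (T : topologicalType) (W : normedModType R).

Lemma continuous_add_at (f g : T -> W) p : {for p, continuous f} ->
  {for p, continuous g} -> {for p, continuous (fun q => f q + g q)}.
Proof. by move=> cf cg; apply: cvgD; [exact: cf|exact: cg]. Qed.

Lemma continuous_sub_at (f g : T -> W) p : {for p, continuous f} ->
  {for p, continuous g} -> {for p, continuous (fun q => f q - g q)}.
Proof. by move=> cf cg; apply: cvgB; [exact: cf|exact: cg]. Qed.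

Lemma continuous_scalec_at (f : T -> R) (a : W) p : {for p, continuous f} ->
  {for p, continuous (fun q => f q *: a)}.
Proof. by move=> cf; apply: cvgZr_tmp; exact: cf. Qed.

Lemma continuous_subc_at (f : T -> W) a p : {for p, continuous f} ->
  {for p, continuous (fun q => f q - a)}.
Proof. by move=> cf; apply: cvgB; [exact: cf|exact: cvg_cst]. Qed.

Lemma continuous_mulrc_at (f : T -> R) a p : {for p, continuous f} ->
  {for p, continuous (fun q => a * f q)}.
Proof. by move=> cf; apply: cvgMl_tmp; exact: cf. Qed.

End ContinuousAt.

Lemma continuous_abs_at (R : realType) (T : topologicalType) (g : T -> R) p :
  {for p, continuous g} -> {for p, continuous (fun q => `|g q|)}.
Proof. by move=> gp; apply: cvg_norm; exact: gp. Qed.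

(** * Euclidean norm and inner product *)

Definition dot (R : realType) (m : nat) (v w : 'cV[R]_m) : R :=
  \sum_(i < m) v i ord0 * w i ord0.

Section Euclidean.
Variables (R : realType) (m : nat).
Implicit Types v w x : 'cV[R]_m.

Lemma dotC v w : dot v w = dot w v.
Proof. by apply: eq_bigr => i _; rewrite mulrC. Qed.

Lemma dotDl v w x : dot (v + w) x = dot v x + dot w x.
Proof. by rewrite -big_split; apply: eq_bigr => i _; rewrite !mxE mulrDl. Qed.

Lemma dotZl a v w : dot (a *: v) w = a * dot v w.
Proof. by rewrite /dot mulr_sumr; apply: eq_bigr => i _; rewrite !mxE mulrA. Qed.

Lemma dotDr v w x : dot x (v + w) = dot x v + dot x w.
Proof. by rewrite !(dotC x) dotDl. Qed.

Lemma dotZr a v w : dot v (a *: w) = a * dot v w.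
Proof. by rewrite !(dotC v) dotZl. Qed.

Lemma dotNr v w : dot v (- w) = - dot v w.
Proof. by rewrite -scaleN1r dotZr mulN1r. Qed.

Lemma dotNl v w : dot (- v) w = - dot v w.
Proof. by rewrite dotC dotNr dotC. Qed.

Lemma enorm_ge0 v : 0 <= enorm v.
Proof. exact: sqrtr_ge0. Qed.

Lemma sqr_enorm v : enorm v ^+ 2 = dot v v.
Proof.
rewrite sqr_sqrtr; first by apply: eq_bigr => i _; rewrite expr2.
by apply: sumr_ge0 => i _; exact: sqr_ge0.
Qed.

Lemma abs_coord_enorm v i : `|v i ord0| <= enorm v.
Proof.
rewrite -(ler_sqr (normr_ge0 _) (enorm_ge0 _)) sqr_enorm real_normK ?num_real//.
rewrite /dot (bigD1 i)//= expr2 lerDl sumr_ge0// => j _.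
by rewrite -expr2 sqr_ge0.
Qed.

Lemma enorm_eq0 v : enorm v = 0 -> v = 0.
Proof.
move=> v0; apply/matrixP => i j; rewrite (ord1 j) mxE; apply/eqP.
by rewrite -normr_le0 -v0 abs_coord_enorm.
Qed.

Lemma enorm0 : enorm (0 : 'cV[R]_m) = 0.
Proof.
by rewrite /enorm big1 ?sqrtr0// => i _; rewrite mxE expr0n.
Qed.

Lemma enormZ a v : enorm (a *: v) = `|a| * enorm v.
Proof.
apply/eqP; rewrite -(eqrXn2 (n := 2)) ?enorm_ge0 ?mulr_ge0 ?enorm_ge0//.
by rewrite exprMn !sqr_enorm dotZl dotZr mulrA -expr2 real_normK ?num_real.
Qed.

Lemma enormN v : enorm (- v) = enorm v.
Proof. by rewrite -scaleN1r enormZ normrN1 mul1r. Qed.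

Lemma cauchy_schwarz v w : dot v w <= enorm v * enorm w.
Proof.
have [/enorm_eq0 ->|v0] := eqVneq (enorm v) 0.
  by rewrite enorm0 mul0r /dot big1// => i _; rewrite mxE mul0r.
have [/enorm_eq0 ->|w0] := eqVneq (enorm w) 0.
  by rewrite enorm0 mulr0 /dot big1// => i _; rewrite mxE mulr0.
have p : 0 < enorm v * enorm w.
  by rewrite mulr_gt0// lt_def ?v0 ?w0 enorm_ge0.
have : 0 <= enorm (enorm w *: v - enorm v *: w) ^+ 2 by exact: sqr_ge0.
rewrite sqr_enorm dotDl !dotDr !dotNl !dotNr !dotZl !dotZr -!sqr_enorm (dotC w).
rewrite [X in 0 <= X](_ : _ = 2 * (enorm v * enorm w * (enorm v * enorm w - dot v w)));
  last by ring.
by rewrite pmulr_rge0// pmulr_rge0// subr_ge0.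
Qed.

Lemma enormD v w : enorm (v + w) <= enorm v + enorm w.
Proof.
rewrite -(@ler_sqr _ (enorm (v + w))) ?nnegrE ?addr_ge0 ?enorm_ge0//.
rewrite sqr_enorm dotDl !dotDr -!sqr_enorm (dotC w) sqrrD.
have := cauchy_schwarz v w; lra.
Qed.

Lemma enorm_le_subD v w : enorm v <= enorm (v - w) + enorm w.
Proof. by rewrite -{1}(subrK w v) enormD. Qed.

Lemma enorm_sum (I : Type) (r : seq I) (P : pred I) (f : I -> 'cV[R]_m) :
  enorm (\sum_(i <- r | P i) f i) <= \sum_(i <- r | P i) enorm (f i).
Proof.
elim/big_rec2: _ => [|i a v _ h]; first by rewrite enorm0.
by rewrite (le_trans (enormD _ _))// lerD2l.
Qed.

Lemma enorm_le_sum v : enorm v <= \sum_i `|v i ord0|.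
Proof.
have {1}-> : v = \sum_i v i ord0 *: delta_mx i ord0.
  by rewrite {1}[v]matrix_sum_delta; apply: eq_bigr => i _; rewrite big_ord1.
apply: (le_trans (enorm_sum _ _ _)); apply: ler_sum => i _.
rewrite enormZ -[leRHS]mulr1 ler_wpM2l//.
rewrite -(@expr_le1 _ 2)// ?enorm_ge0// sqr_enorm /dot (bigD1 i)//= big1.
  by rewrite !mxE !eqxx mulr1 addr0.
by move=> j ji; rewrite !mxE (negPf ji) mulr0.
Qed.

Lemma enorm_mono v w :
  (forall i, `|v i ord0| <= `|w i ord0|) -> enorm v <= enorm w.
Proof.
move=> h; rewrite ler_wsqrtr// ler_sum// => i _.
by rewrite -(real_normK (num_real (v i ord0))) -(real_normK (num_real (w i ord0)))
  ler_sqr ?nnegrE.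
Qed.

Lemma abs_coord_le_norm (v : 'cV[R]_m) i : `|v i ord0| <= `|v|.
Proof. by rewrite /Num.Def.normr/= mx_normrE; apply: (le_bigmax _ _ (i, ord0)). Qed.

(** The library norm [|v|] is the maximum norm, which carries the topology; this bound and
    [norm_le_enorm] transfer continuity and boundedness between the two norms. *)
Lemma enorm_le_norm (v : 'cV[R]_m) : enorm v <= m%:R * `|v|.
Proof.
apply: (le_trans (enorm_le_sum _)).
rewrite (le_trans (ler_sum _ (fun i _ => abs_coord_le_norm v i)))//.
by rewrite sumr_const card_ord mulr_natl.
Qed.

Lemma norm_le_enorm (v : 'cV[R]_m) : `|v| <= enorm v.
Proof.
rewrite /Num.Def.normr/= mx_normrE; apply: bigmax_le; first exact: enorm_ge0.
by move=> [i j] _; rewrite /= (ord1 j) abs_coord_enorm.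
Qed.

Lemma continuous_enorm : continuous (@enorm R m).
Proof.
apply: (@lipschitz_continuous _ _ _ m%:R) => v w.
have h (a b : 'cV[R]_m) : enorm a - enorm b <= m%:R * `|a - b|.
  by rewrite lerBlDr (le_trans (enorm_le_subD a b))// lerD2r enorm_le_norm.
rewrite ler_norml; apply/andP; split; last exact: h.
by rewrite lerNl opprB (le_trans (h _ _))// distrC.
Qed.

Lemma continuous_enorm_comp (T : topologicalType) (g : T -> 'cV[R]_m) p :
  {for p, continuous g} -> {for p, continuous (fun y => enorm (g y))}.
Proof. by move=> gp; apply: continuous_comp gp _; exact: continuous_enorm. Qed.

Lemma closed_enorm_le (T : topologicalType) (g : T -> 'cV[R]_m) (b : R) :
  continuous g -> closed [set y | enorm (g y) <= b].
Proof.
move=> cg; apply: (@preimage_closed _ _ (fun y => enorm (g y)) [set a | a <= b]).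
  by move=> y _; apply: continuous_enorm_comp; exact: cg.
exact: closed_le.
Qed.

(* [bounded_closed_compact] is stated for row vectors only. *)
Lemma closed_bounded_compact (K : set 'cV[R]_m) (B : R) :
  closed K -> (forall v, K v -> enorm v <= B) -> compact K.
Proof.
move=> Kc KB; pose K' := (fun x : 'rV[R]_m => x^T) @^-1` K.
have ct (a b : nat) : continuous (fun x : 'M[R]_(a, b) => x^T).
  apply: (@lipschitz_continuous _ _ _ 1) => x y.
  rewrite mul1r -linearB/= {1}/Num.Def.normr/= mx_normrE.
  apply: bigmax_le => // -[i j] _; rewrite mxE.
  by rewrite [leRHS]/Num.Def.normr/= mx_normrE; apply: (le_bigmax _ _ (j, i)).
have -> : K = (fun x : 'rV[R]_m => x^T) @` K'.
  rewrite eqEsubset; split=> [v Kv|_ [v Kv <-]//].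
  by exists v^T; rewrite /K' /= trmxK.
apply: continuous_compact; first exact/continuous_subspaceT/ct.
apply: bounded_closed_compact; last by apply: preimage_closed Kc => x _; exact: ct.
exists B; split; first exact: num_real.
move=> x Bx v Kv; apply: (le_trans _ (ltW Bx)); apply: (le_trans _ (KB _ Kv)).
apply: (le_trans _ (norm_le_enorm _)).
rewrite {1}/Num.Def.normr/= mx_normrE; apply: bigmax_le => // -[i j] _ /=.
rewrite [leRHS]/Num.Def.normr/= mx_normrE.
by have := le_bigmax 0 (fun ij => `|v^T ij.1 ij.2|) (j, i); rewrite /= mxE.
Qed.

End Euclidean.

(** * Coordinate blocks, integer translations and distance on the torus *)

Section ChartGeometry.
Variables (R : realType) (c u s : nat).
Local Notation V := 'cV[R]_(c + u + s).
Implicit Types (v w p q m : V) (P Q : pred 'I_(c + u + s)).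

Lemma cprojD P v w : cproj P (v + w) = cproj P v + cproj P w.
Proof. by apply/matrixP => i j; rewrite !mxE; case: (P i); rewrite ?addr0. Qed.

Lemma cprojZ P a v : cproj P (a *: v) = a *: cproj P v.
Proof. by apply/matrixP => i j; rewrite !mxE; case: (P i); rewrite ?mulr0. Qed.

Lemma cprojN P v : cproj P (- v) = - cproj P v.
Proof. by rewrite -scaleN1r cprojZ scaleN1r. Qed.

Lemma cprojB P v w : cproj P (v - w) = cproj P v - cproj P w.
Proof. by rewrite cprojD cprojN. Qed.

Lemma cproj0 P : cproj P (0 : V) = 0.
Proof. by rewrite -(scale0r 0) cprojZ !scale0r. Qed.

Lemma cproj_cproj P Q v : cproj P (cproj Q v) = cproj (predI P Q) v.
Proof. by apply/matrixP => i j; rewrite !mxE /=; case: (P i). Qed.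

Lemma cproj_sub_id P Q v : (forall i, P i -> Q i) -> cproj P (cproj Q v) = cproj P v.
Proof.
move=> PQ; rewrite cproj_cproj; apply/matrixP => i j; rewrite !mxE /=.
by case: (boolP (P i)) => // /PQ ->.
Qed.

Lemma cproj_disjoint P Q v : (forall i, P i -> ~~ Q i) -> cproj P (cproj Q v) = 0.
Proof.
move=> PQ; rewrite cproj_cproj; apply/matrixP => i j; rewrite !mxE /=.
by case: (boolP (P i)) => // /PQ /negPf ->.
Qed.

Lemma cprojK P v : cproj P (cproj P v) = cproj P v.
Proof. exact: cproj_sub_id. Qed.

Lemma enorm_cproj_sub P Q v : (forall i, P i -> Q i) ->
  enorm (cproj P v) <= enorm (cproj Q v).
Proof.
move=> PQ; apply: enorm_mono => i; rewrite !mxE.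
by case: (boolP (P i)) => [/PQ ->//|_]; rewrite normr0.
Qed.

Lemma enorm_cproj P v : enorm (cproj P v) <= enorm v.
Proof.
by apply: enorm_mono => i; rewrite !mxE; case: (P i); rewrite ?normr0.
Qed.

Lemma isLX_isY (i : 'I_(c + u + s)) : isY i = ~~ isLX i.
Proof. by rewrite /isY /isLX leqNgt. Qed.

Lemma isL_isLX (i : 'I_(c + u + s)) : isL i -> isLX i.
Proof. by rewrite /isL /isLX => h; apply: leq_trans h _; apply: leq_addr. Qed.

Lemma isX_isLX (i : 'I_(c + u + s)) : isX i -> isLX i.
Proof. by rewrite /isX /isLX => /andP[]. Qed.

Lemma isX_isL (i : 'I_(c + u + s)) : isX i -> ~~ isL i.
Proof. by rewrite /isX /isL -leqNgt => /andP[]. Qed.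

Lemma isY_isL (i : 'I_(c + u + s)) : isY i -> ~~ isL i.
Proof. by rewrite isLX_isY; apply: contra; exact: isL_isLX. Qed.

Lemma isY_isX (i : 'I_(c + u + s)) : isY i -> ~~ isX i.
Proof. by rewrite isLX_isY; apply: contra; exact: isX_isLX. Qed.

Lemma cproj_LX_Y v : v = cproj isLX v + cproj isY v.
Proof.
apply/matrixP => i j; rewrite !mxE (ord1 j) isLX_isY.
by case: (isLX i); rewrite ?addr0 ?add0r.
Qed.

Lemma enorm_LX_Y v : enorm v <= enorm (cproj isLX v) + enorm (cproj isY v).
Proof. by rewrite {1}(cproj_LX_Y v) enormD. Qed.

Lemma continuous_cproj P : continuous (fun v => cproj P v).
Proof.
apply: (@lipschitz_continuous _ _ _ (c + u + s)%:R) => v w.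
rewrite -cprojB (le_trans (norm_le_enorm _))//.
by rewrite (le_trans (enorm_cproj _ _))// enorm_le_norm.
Qed.

Lemma shiftsN m : shifts m -> shifts (- m).
Proof.
move=> hm i; have := hm i; rewrite !mxE; case: ifP => // _; first by rewrite rpredN.
by move=> ->; rewrite oppr0.
Qed.

Lemma shiftsD m m' : shifts m -> shifts m' -> shifts (m + m').
Proof.
move=> hm hm' i; have := hm i; have := hm' i; rewrite !mxE.
by case: ifP => _; [exact: (fun x y => rpredD y x)|move=> -> ->; rewrite addr0].
Qed.

Lemma shifts0 : shifts (0 : V).
Proof. by move=> i; rewrite mxE; case: ifP. Qed.

Lemma cproj_shifts P m : shifts m -> (forall i, P i -> ~~ isL i) -> cproj P m = 0.
Proof.
move=> hm PL; apply/matrixP => i j; rewrite (ord1 j) !mxE.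
by case: ifPn => // /PL /negPf iL; have := hm i; rewrite iL.
Qed.

Lemma cprojX_shift p q : shifts (p - q) -> cproj isX p = cproj isX q.
Proof.
by move=> h; rewrite -(subrK q p) cprojD (cproj_shifts h) ?add0r// => i; exact: isX_isL.
Qed.

Lemma cprojY_shift p q : shifts (p - q) -> cproj isY p = cproj isY q.
Proof.
by move=> h; rewrite -(subrK q p) cprojD (cproj_shifts h) ?add0r// => i; exact: isY_isL.
Qed.

Lemma Dom_shift r p m : Dom r p -> shifts m -> Dom r (p + m).
Proof.
move=> [px py] hm; split; rewrite cprojD (cproj_shifts hm) ?addr0// => i.
  exact: isX_isL.
exact: isY_isL.
Qed.

Lemma Dom_split r p q v : Dom r p -> Dom r q ->
  cproj isX v = cproj isX p -> cproj isY v = cproj isY q -> Dom r v.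
Proof. by move=> [px _] [_ qy] hx hy; split; rewrite ?hx ?hy. Qed.

Lemma enorm_convex n (v w : 'cV[R]_n) r (t : R) : enorm v <= r -> enorm (v + w) <= r ->
  0 <= t <= 1 -> enorm (v + t *: w) <= r.
Proof.
move=> hv hw /andP[t0 t1].
have -> : v + t *: w = (1 - t) *: v + t *: (v + w).
  by rewrite scalerDr addrA -scalerDl subrK scale1r.
rewrite (le_trans (enormD _ _))// !enormZ (ger0_norm t0) ger0_norm ?subr_ge0//.
by rewrite (_ : r = (1 - t) * r + t * r) ?lerD ?ler_wpM2l ?subr_ge0//; ring.
Qed.

Lemma Dom_convex r p v (t : R) : Dom r p -> Dom r (p + v) -> 0 <= t <= 1 ->
  Dom r (p + t *: v).
Proof.
move=> [px py] [qx qy] ht; rewrite cprojD in qx; rewrite cprojD in qy.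
by split; rewrite cprojD cprojZ enorm_convex.
Qed.

Lemma closed_Dom r : closed (@Dom R c u s r).
Proof.
have -> : Dom r = [set p : V | enorm (cproj isX p) <= r] `&`
    [set p : V | enorm (cproj isY p) <= r] by [].
by apply: closedI; apply: closed_enorm_le; exact: continuous_cproj.
Qed.

Lemma abs_le_half_int (a k : R) : `|a| <= 2^-1 -> k \is a Num.int -> `|a| <= `|a + k|.
Proof.
move=> ha hk; have [->|k0] := eqVneq k 0; first by rewrite addr0.
have k1 : 1 <= `|k| by rewrite norm_intr_ge1.
have : `|k| <= `|a + k| + `|a|.
  by rewrite -{1}(addKr a k) addrC (le_trans (ler_normB _ _)).
lra.
Qed.

Lemma has_lbound_tdist P v :
  has_lbound [set enorm (cproj P (v + m)) | m in shifts].
Proof. by exists 0 => _ [m _ <-]; exact: enorm_ge0. Qed.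

Lemma tdist_le P v m : shifts m -> tdist P v <= enorm (cproj P (v + m)).
Proof. by move=> hm; apply: (ge_inf (has_lbound_tdist P v)); exists m. Qed.

Lemma tdist_le0 P v : tdist P v <= enorm (cproj P v).
Proof. by rewrite -{2}(addr0 v) tdist_le//; exact: shifts0. Qed.

Lemma tdist_shift P v m : shifts m -> tdist P (v + m) = tdist P v.
Proof.
move=> hm; congr inf; rewrite eqEsubset; split=> _ [m' hm' <-].
  by exists (m + m'); rewrite ?addrA//; exact: shiftsD.
exists (m' - m); first by apply: shiftsD => //; exact: shiftsN.
by rewrite addrACA subrr addr0 -?addrA ?(addrC m) ?addrA.
Qed.

(** The translations form a product lattice, so the norm is minimised coordinate by coordinate, and
    a coordinate in [-1/2, 1/2] is already the smallest in its class. *)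
Lemma tdist_small P v : (forall i, isL i -> `|v i ord0| <= 2^-1) ->
  tdist P v = enorm (cproj P v).
Proof.
move=> hv; apply/eqP; rewrite eq_le tdist_le0/=.
apply: lb_le_inf; first by exists (enorm (cproj P (v + 0))); exists 0 => //; exact: shifts0.
move=> _ [m hm <-]; apply: enorm_mono => i; rewrite !mxE; case: (P i) => //.
have := hm i; case: ifP => [/hv h|_ ->]; last by rewrite addr0.
exact: abs_le_half_int.
Qed.

Lemma tdist_attained P v : exists m, [/\ shifts m,
  (forall i, isL i -> `|(v + m) i ord0| <= 2^-1) &
  tdist P v = enorm (cproj P (v + m))].
Proof.
(* Subtract from each lambda-coordinate its nearest integer. *)
pose m : V := \col_i (if isL i then - (Num.floor (v i ord0 + 2^-1))%:~R else 0).
have hm : shifts m.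
  by move=> i; rewrite mxE; case: (isL i); rewrite // rpredN intr_int.
have hs i : isL i -> `|(v + m) i ord0| <= 2^-1.
  move=> iL; rewrite !mxE iL; have /andP[] := floor_itv (v i ord0 + 2^-1).
  rewrite intrD; move: (_%:~R) => k h1 h2; rewrite ler_norml; lra.
by exists m; split=> //; rewrite -(tdist_shift P v hm) tdist_small.
Qed.

Lemma tdist_ge0 P v : 0 <= tdist P v.
Proof. by have [m [_ _ ->]] := tdist_attained P v; exact: enorm_ge0. Qed.

Lemma tdistD P v w : tdist P (v + w) <= tdist P v + tdist P w.
Proof.
have [m [hm _ ->]] := tdist_attained P v; have [m' [hm' _ ->]] := tdist_attained P w.
rewrite (le_trans (tdist_le P _ (shiftsD hm hm')))//.
by rewrite addrACA (cprojD P (v + m)) enormD.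
Qed.

Lemma tdistN P v : tdist P (- v) = tdist P v.
Proof.
suff h (w : V) : tdist P (- w) <= tdist P w.
  by apply/eqP; rewrite eq_le h -{1}(opprK v) h.
have [m [hm _ ->]] := tdist_attained P w.
by rewrite (le_trans (tdist_le P _ (shiftsN hm)))// -opprD cprojN enormN.
Qed.

Lemma tdist_congr P p q : shifts (p - q) -> tdist P p = tdist P q.
Proof. by move=> h; rewrite -(tdist_shift P q h) addrC subrK. Qed.

Lemma abs_coord_cproj_L P v i (r : R) : (forall i, isL i -> P i) ->
  enorm (cproj P v) <= r -> isL i -> `|v i ord0| <= r.
Proof.
move=> LP h iL; apply: (le_trans _ h).
by have := abs_coord_enorm (cproj P v) i; rewrite mxE (LP _ iL).
Qed.

(** Different lifts differ by at least 1 in some coordinate. This identifies the end of the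
    continued path as a lift and not merely as a point of the torus. *)
Lemma shifts_small m (v : V) : shifts m -> enorm (cproj isL v) < 2^-1 ->
  enorm (cproj isL (v + m)) < 2^-1 -> m = 0.
Proof.
move=> hm hv hw; apply/matrixP => i j; rewrite (ord1 j) mxE.
have := hm i; case: ifP => // iL hi; apply/eqP; apply: contraT => m0.
have := norm_intr_ge1 hi m0.
have h1 : `|v i ord0| < 2^-1.
  by apply: le_lt_trans hv; apply: (abs_coord_cproj_L (P := isL)).
have h2 : `|(v + m) i ord0| < 2^-1.
  by apply: le_lt_trans hw; apply: (abs_coord_cproj_L (P := isL)).
rewrite mxE in h2; have : `|m i ord0| <= `|v i ord0 + m i ord0| + `|v i ord0|.
  by rewrite -{1}(addKr (v i ord0) (m i ord0)) addrC (le_trans (ler_normB _ _)).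
lra.
Qed.

End ChartGeometry.

(** * Directional derivatives and their linearity in the direction *)

Section DirectionalDerivative.
Variables (R : realType) (V : normedModType R).

Lemma is_derive_line (f : V -> R) a v t l :
  is_derive (a + t *: v) v f l <-> is_derive t 1 (fun r : R => f (a + r *: v)) l.
Proof.
have E : (fun h : R => h^-1 *: (((fun r : R => f (a + r *: v)) \o shift t) (h *: 1)
             - f (a + t *: v))) =
         (fun h => h^-1 *: ((f \o shift (a + t *: v)) (h *: v) - f (a + t *: v))).
  apply/funext => h /=; rewrite [h *: 1]mulr1 scalerDl.
  by rewrite addrCA.
have D : derivable (fun r : R => f (a + r *: v)) t 1 = derivable f (a + t *: v) v.
  by rewrite /derivable E.
have D' : 'D_1 (fun r : R => f (a + r *: v)) t = 'D_v f (a + t *: v).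
  by rewrite /derive E.
split=> -[d1 d2]; split.
- by rewrite D.
- by rewrite D'.
- by rewrite -D.
- by rewrite -D'.
Qed.

Lemma is_derive_scale_dir (f : V -> R) a v k l :
  is_derive a v f l -> is_derive a (k *: v) f (k * l).
Proof.
move=> H; rewrite -[a](addr0 a) -(scale0r (k *: v)); apply/is_derive_line.
have H' : is_derive (k * 0 : R) 1 (fun r : R => f (a + r *: v)) l.
  by apply/is_derive_line; rewrite mulr0 scale0r addr0.
have K : is_derive (0 : R) 1 ( *%R k) k.
  by apply: is_derive_eq; rewrite [_ *: _]mulr1.
rewrite (_ : (fun r : R => _) = (fun r : R => f (a + r *: v)) \o ( *%R k)).
  by rewrite mulrC; exact: is_derive1_comp.
by apply/funext => r /=; rewrite scalerA mulrC.
Qed.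

Lemma MVT_line (f : V -> R) a v (df : V -> R) :
  (forall t : R, 0 <= t <= 1 -> is_derive (a + t *: v) v f (df (a + t *: v))) ->
  exists2 t : R, 0 <= t <= 1 & f (a + v) - f a = df (a + t *: v).
Proof.
move=> H.
have H' (t : R) : 0 <= t <= 1 ->
    is_derive t 1 (fun r : R => f (a + r *: v)) (df (a + t *: v)).
  by move=> /H /is_derive_line.
have [|||t t01] := @MVT_segment R (fun r : R => f (a + r *: v))
    (fun t => df (a + t *: v)) 0 1.
- exact: ler01.
- by move=> x /itvP x01; apply: H'; rewrite !x01.
- by apply: derivable_within_continuous => x /itvP x01; have [] := H' x; rewrite ?x01.
rewrite scale1r scale0r addr0 subr0 mulr1 => E.
by exists t => //; move: t01; rewrite in_itv.
Qed.

(** A division-free form, in which h = 0 is allowed, so that error terms of several derivatives can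
    simply be added. *)
Lemma is_derive_eps (W : normedModType R) (f : V -> W) a v l : is_derive a v f l <->
  forall e : R, 0 < e -> exists2 d : R, 0 < d & forall h : R, `|h| <= d ->
    `|f (a + h *: v) - f a - h *: l| <= e * `|h|.
Proof.
split=> [[d1 d2] e e0|H].
- have : (h^-1 *: ((f \o shift a) (h *: v) - f a)) @[h --> 0^'] --> l.
    by rewrite -d2; exact: d1.
  move=> /cvgrPdist_le /(_ _ e0) [d d0 Hd]; exists (d / 2); first exact: divr_gt0.
  move=> h hd; have [->|h0] := eqVneq h 0.
    by rewrite !scale0r addr0 subrr subr0 !normr0 mulr0.
  have /= := Hd h; rewrite /ball_ /= sub0r normrN => /(_ _ h0) H.
  have {}H := H (le_lt_trans hd _).
  have -> : f (a + h *: v) - f a - h *: l =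
      - h *: (l - h^-1 *: (f (h *: v + a) - f a)).
    rewrite scalerBr !scaleNr opprK scalerA mulfV// scale1r addrC.
    by rewrite (addrC (h *: v)).
  rewrite normrZ normrN mulrC ler_wpM2r//; apply: H.
  by rewrite ltr_pdivrMr// ltr_pMr// ltr1n.
- have C : (h^-1 *: ((f \o shift a) (h *: v) - f a)) @[h --> 0^'] --> l.
    apply/cvgrPdist_le => e e0; have [d d0 Hd] := H _ e0.
    exists d => //= h; rewrite /ball_ /= sub0r normrN => hd h0.
    rewrite -(ler_pM2l (_ : 0 < `|h|)) ?normr_gt0//.
    rewrite -normrZ scalerBr scalerA mulfV// scale1r -normrN opprB mulrC.
    by rewrite (addrC (h *: v)) Hd// ltW.
  by split; [apply/cvg_ex; exists l|exact/cvg_lim].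
Qed.

(** Go along v first, where derivability at p suffices, then along w from p + h v, where the mean
    value theorem gives the w-derivative at a nearby point and continuity of [dw] at p compares it
    with [dw p]. Each leg gets half of the error e. *)
Lemma is_deriveD_dir (U : set V) (f dw : V -> R) v w k p l : open U ->
  (forall q, U q -> is_derive q w f (dw q)) ->
  {for p, continuous dw} -> U p -> is_derive p v f l ->
  is_derive p (v + k *: w) f (l + k * dw p).
Proof.
move=> oU Hw cw Up Hv; apply/is_derive_eps => e e0.
have e3 : 0 < e / (2 * (`|k| + 1)) by rewrite divr_gt0// mulr_gt0// ltr_wpDl.
have [d1 d10 H1] := (is_derive_eps _ _ _ _).1 Hv _ (divr_gt0 e0 (ltr0n _ 2)).
have [d2 d20 H2] : exists2 d : R, 0 < d & forall x, `|x| < d ->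
    U (p + x) /\ `|dw (p + x) - dw p| <= e / (2 * (`|k| + 1)).
  have cw' : \forall q \near p, `|dw q - dw p| <= e / (2 * (`|k| + 1)).
    by move/cvgrPdist_le : cw => /(_ _ e3); apply: filterS => q; rewrite distrC.
  have : \forall q \near p, U q /\ `|dw q - dw p| <= e / (2 * (`|k| + 1)).
    near=> q; split; first by near: q; exact: open_nbhs_nbhs.
    by near: q.
  move=> /nbhs_ballP[d d0 Hd]; exists d => // x xd; apply: Hd.
  by rewrite -ball_normE /ball_ /= opprD addrA subrr sub0r normrN.
(* Every point of the two legs is within [|h| * B] of p. *)
pose B := `|v| + `|k| * `|w| + 1.
have B0 : 0 < B by rewrite /B ltr_wpDl// addr_ge0// mulr_ge0.
exists (Num.min d1 (d2 / (2 * B))); first by rewrite lt_min d10 divr_gt0// mulr_gt0.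
move=> h; rewrite le_min => /andP[hd1 hd2].
have small (t : R) : 0 <= t <= 1 -> `|h *: v + t *: ((h * k) *: w)| < d2.
  move=> /andP[t0 t1]; apply: (@le_lt_trans _ _ (`|h| * B)).
    rewrite (le_trans (ler_normD _ _))// !normrZ ?normrM /B.
    rewrite (ger0_norm t0) !mulrDr -addrA lerD2l ler_wpDr ?mulr1//.
    by rewrite -mulrA ler_piMl// !mulr_ge0.
  rewrite ler_pdivlMr ?mulr_gt0// in hd2.
  have := mulr_ge0 (normr_ge0 h) (ltW B0); lra.
have [|t t01 Et] := @MVT_line f (p + h *: v) ((h * k) *: w) (fun q => (h * k) * dw q).
  move=> t t01; apply: is_derive_scale_dir; apply: Hw; rewrite -addrA.
  by have [] := H2 _ (small t t01).
have [_ H3] := H2 _ (small t t01).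
have -> : f (p + h *: (v + k *: w)) - f p - h *: (l + k * dw p) =
    (f (p + h *: v) - f p - h *: l) +
    h * k * (dw (p + (h *: v + t *: ((h * k) *: w))) - dw p).
  rewrite (mulrBr (h * k)) !addrA -{}Et scalerDr scalerA addrA.
  by rewrite /GRing.scale/=; ring.
rewrite (le_trans (ler_normD _ _))//.
have -> : e * `|h| = e / 2 * `|h| + e / 2 * `|h| by lra.
rewrite lerD ?H1// !normrM [leRHS]mulrC -mulrA ler_wpM2l//.
rewrite (le_trans (ler_wpM2l (normr_ge0 _) H3))//.
have k1 : 0 < `|k| + 1 by rewrite ltr_wpDl.
rewrite mulrA ler_pdivrMr ?mulr_gt0// mulrA divfK// mulrC ler_wpM2l// ?ltW//.
by rewrite ltrDl.
Unshelve. all: by end_near. Qed.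

Lemma is_derive_lincomb (I : Type) (r : seq I) (U : set V) (f : V -> R)
    (e : I -> V) (a : I -> R) (d : I -> V -> R) p : open U -> U p ->
  (forall i q, U q -> is_derive q (e i) f (d i q)) ->
  (forall i, {for p, continuous (d i)}) ->
  is_derive p (\sum_(i <- r) a i *: e i) f (\sum_(i <- r) a i * d i p).
Proof.
move=> oU Up He cd; elim: r => [|i r IH]; first by rewrite !big_nil; exact: is_derive0.
rewrite !big_cons addrC [X in is_derive _ _ _ X]addrC.
by apply: (is_deriveD_dir _ oU) IH => //; exact: He.
Qed.

End DirectionalDerivative.

(** * The Jacobian of a C^1 lift *)

Section Jacobian.
Variables (R : realType) (c u s : nat).
Local Notation V := 'cV[R]_(c + u + s).

(** The working form of C^1: [Ck] speaks of iterated partial derivatives, whereas the mean value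
    arguments need the derivative in every direction. *)
Definition C1_on (U : set V) (F : V -> V) :=
  [/\ forall p, U p -> {for p, continuous F},
      forall p i j, U p -> {for p, continuous (fun q => Jac F q i j)} &
      forall p v, U p -> is_derive p v F (Jac F p *m v)].

Lemma is_derive_mx (F : V -> V) p v (l : V) :
  is_derive p v F l <-> forall i, is_derive p v (fun q => F q i ord0) (l i ord0).
Proof.
split=> [[d1 d2] i|H].
  split; first by move/derivable_mxP : d1; apply.
  by rewrite -d2 derive_mx// mxE.
have D : derivable F p v by apply/derivable_mxP => i j; rewrite (ord1 j); have [] := H i.
split=> //; rewrite derive_mx//; apply/matrixP => i j; rewrite (ord1 j) mxE.
by have [] := H i.
Qed.

Lemma Ck_C1 k (U : set V) (F : V -> V) : open U -> Ck k.+1 U F -> C1_on U F.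
Proof.
move=> oU H.
have cF p : U p -> {for p, continuous F} by have [+ _] := H [::] isT; apply.
have dF j p : U p -> derivable F p (delta_mx j ord0) by have [_ +] := H [::] isT; apply.
have cJ p i j : U p -> {for p, continuous (fun q => Jac F q i j)}.
  have [/(_ p) cd _] := H [:: j] isT => Up.
  rewrite (_ : (fun q => _) = (fun q => derive F q (delta_mx j ord0) i ord0)).
    by apply: (@continuous_comp _ _ _ _ (fun x : V => x i ord0)); [exact: cd|exact: coord_continuous].
  by apply/funext => q; rewrite mxE.
split=> // p v Up; apply/is_derive_mx => i.
have -> : v = \sum_j v j ord0 *: delta_mx j ord0.
  by rewrite {1}[v]matrix_sum_delta; apply: eq_bigr => j _; rewrite big_ord1.
rewrite [X in is_derive _ _ _ X](_ : _ = \sum_j v j ord0 * Jac F p i j).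
  apply: (@is_derive_lincomb _ _ _ _ U _ _ _ (fun j q => Jac F q i j)) => // [j q Uq|j]; last exact: cJ.
  rewrite mxE; have [] := is_derive_mx F q (delta_mx j ord0) ('D_(delta_mx j ord0) F q).
  by move=> + _; apply; split => //; exact: dF.
rewrite mxE; apply: eq_bigr => j _; rewrite mulrC; congr (_ * _).
rewrite summxE (bigD1 j)//= big1 ?addr0 => [|k' kj]; rewrite !mxE ?eqxx ?mulr1//.
by rewrite eq_sym (negPf kj) mulr0.
Qed.

End Jacobian.

(** * Operator norm and minimal expansion of matrix blocks *)

Section BlockNorms.
Variables (R : realType) (c u s : nat).
Local Notation V := 'cV[R]_(c + u + s).
Local Notation M := 'M[R]_(c + u + s).
Implicit Types (A : M) (v : V) (I J : pred 'I_(c + u + s)).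

Lemma enorm_mulmx A v : enorm (A *m v) <= (\sum_i \sum_j `|A i j|) * enorm v.
Proof.
rewrite (le_trans (enorm_le_sum _))// mulr_suml ler_sum// => i _.
rewrite mxE (le_trans (ler_norm_sum _ _ _))// mulr_suml ler_sum// => j _.
by rewrite normrM ler_wpM2l// abs_coord_enorm.
Qed.

(** Makes the supremum in [bnorm] a genuine one; the crude bound by the entries becomes uniform over
    D once the Jacobian is bounded. *)
Lemma bnorm_ubound I J A :
  ubound [set enorm (cproj I (A *m v)) | v in [set v | cproj J v = v /\ enorm v <= 1]]
    (\sum_i \sum_j `|A i j|).
Proof.
move=> _ [v [_ v1] <-]; rewrite (le_trans (enorm_cproj _ _))//.
rewrite (le_trans (enorm_mulmx _ _))// ler_piMr// sumr_ge0// => i _.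
by rewrite sumr_ge0.
Qed.

Lemma enorm_block_le I J A v :
  enorm (cproj I (A *m cproj J v)) <= bnorm I J A * enorm (cproj J v).
Proof.
have [/enorm_eq0 ->|v0] := eqVneq (enorm (cproj J v)) 0.
  by rewrite mulmx0 cproj0 enorm0 mulr0.
have vp : 0 < enorm (cproj J v) by rewrite lt_def v0 enorm_ge0.
rewrite -ler_pdivrMr//.
apply: ub_le_sup; first by exists (\sum_i \sum_j `|A i j|); exact: bnorm_ubound.
exists ((enorm (cproj J v))^-1 *: cproj J v).
  split; first by rewrite cprojZ cprojK.
  by rewrite enormZ ger0_norm ?invr_ge0 ?enorm_ge0// mulVf.
by rewrite -scalemxAr cprojZ enormZ ger0_norm ?invr_ge0 ?enorm_ge0// mulrC.
Qed.

Lemma bnorm_ge0 I J A : 0 <= bnorm I J A.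
Proof.
apply: ub_le_sup; first by exists (\sum_i \sum_j `|A i j|); exact: bnorm_ubound.
by exists 0; [split; rewrite ?cproj0 ?enorm0|rewrite mulmx0 cproj0 enorm0].
Qed.

Lemma bnorm_le I J A : bnorm I J A <= \sum_i \sum_j `|A i j|.
Proof.
apply: ge_sup; last exact: bnorm_ubound.
by exists (enorm (cproj I (A *m 0))), 0; split; rewrite ?cproj0 ?enorm0.
Qed.

Lemma inf_ge0 (S : set R) : (forall x, S x -> 0 <= x) -> 0 <= inf S.
Proof.
(* The infimum of the empty set is 0, so no unit vector of the block has to be exhibited. *)
move=> S0; have [->|/set0P[x Sx]] := eqVneq S set0; first by rewrite inf0.
by apply: lb_le_inf; [exists x|].
Qed.

Lemma bm_ge0 I J A : 0 <= bm I J A.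
Proof. by apply: inf_ge0 => _ [v _ <-]; exact: enorm_ge0. Qed.

Lemma bm_le_enorm_block I J A v :
  bm I J A * enorm (cproj J v) <= enorm (cproj I (A *m cproj J v)).
Proof.
have [->|v0] := eqVneq (enorm (cproj J v)) 0; first by rewrite mulr0 enorm_ge0.
have vp : 0 < enorm (cproj J v) by rewrite lt_def v0 enorm_ge0.
rewrite -ler_pdivlMr//; apply: ge_inf.
  by exists 0 => _ [w _ <-]; exact: enorm_ge0.
exists ((enorm (cproj J v))^-1 *: cproj J v).
  split; first by rewrite cprojZ cprojK.
  by rewrite enormZ ger0_norm ?invr_ge0 ?enorm_ge0// mulVf.
by rewrite -scalemxAr cprojZ enormZ ger0_norm ?invr_ge0 ?enorm_ge0// mulrC.
Qed.

End BlockNorms.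

(** * Periodicity and boundedness of the Jacobian on D *)

Section JacobianBounds.
Variables (R : realType) (c u s : nat).
Local Notation V := 'cV[R]_(c + u + s).
Variables (r : R) (U : set V) (F : V -> V).

(** On D the difference of F at q + m and at q has integer entries. Between q = p and q = p + h v it
    changes by O(h), hence not at all for small h, and the difference quotients at p and p + m
    agree. Interior points are taken so that p + h v stays in D for every coordinate direction v. *)
Lemma Jac_periodic_interior (p m : V) :
  C1_on U F -> Dom r `<=` U -> is_lift r F -> shifts m ->
  enorm (cproj isX p) < r -> enorm (cproj isY p) < r -> Jac F (p + m) = Jac F p.
Proof.
move=> [_ _ dF] DU FL hm px py.
have Dp : Dom r p by split; exact: ltW.
apply/matrixP => i j; pose v : V := delta_mx j ord0.
have v1 : enorm v <= 1.
  rewrite (le_trans (enorm_le_sum _))// (bigD1 j)//= big1 => [|k kj].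
    by rewrite mxE !eqxx normr1 addr0.
  by rewrite mxE (negPf kj) normr0.
have Jv q : Jac F q i j = (Jac F q *m v) i ord0.
  by rewrite /v -colE [RHS]mxE.
have [l1 El1] := ex_intro (fun l => l = Jac F (p + m) i j) _ erefl.
have [l2 El2] := ex_intro (fun l => l = Jac F p i j) _ erefl.
have D1 : is_derive (p + m) v (fun q => F q i ord0) l1.
  by rewrite El1 Jv; exact: (is_derive_mx F _ v _).1 (dF _ v (DU _ (Dom_shift Dp hm))) i.
have D2 : is_derive p v (fun q => F q i ord0) l2.
  by rewrite El2 Jv; exact: (is_derive_mx F _ v _).1 (dF _ v (DU _ Dp)) i.
rewrite -El1 -El2.
apply/eqP; rewrite -subr_eq0 -normr_le0; apply/ler_addgt0Pr => e e0; rewrite add0r.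
have e2 : 0 < e / 2 by rewrite divr_gt0.
have [d1 d10 H1] := (is_derive_eps _ _ _ _).1 D1 _ e2.
have [d2 d20 H2] := (is_derive_eps _ _ _ _).1 D2 _ e2.
have [rho rho0 [rhox rhoy]] : exists2 rho, 0 < rho &
    rho <= r - enorm (cproj isX p) /\ rho <= r - enorm (cproj isY p).
  exists (Num.min (r - enorm (cproj isX p)) (r - enorm (cproj isY p))).
    by rewrite lt_min !subr_gt0 px py.
  by rewrite !ge_min !lexx orbT.
(* With h <= 1/(2K), the integer k below has absolute value at most h (e + |l1 - l2|) < 1, so it
   vanishes. *)
pose K := e + `|l1 - l2| + 1.
have K0 : 0 < K by rewrite /K ltr_wpDl// addr_ge0// ltW.
pose h := Num.min (Num.min d1 d2) (Num.min rho (2 * K)^-1).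
have h0 : 0 < h by rewrite /h !lt_min d10 d20 rho0 invr_gt0 mulr_gt0.
have hh : `|h| = h by rewrite ger0_norm// ltW.
have [h1 h2 h3 h4] : [/\ h <= d1, h <= d2, h <= rho & h <= (2 * K)^-1].
  by rewrite /h !ge_min !lexx ?orbT.
have Dph : Dom r (p + h *: v).
  have [hx hy] : h <= r - enorm (cproj isX p) /\ h <= r - enorm (cproj isY p).
    by split; exact: le_trans h3 _.
  have hv P : enorm (cproj P (h *: v)) <= h.
    rewrite cprojZ enormZ hh ler_piMr ?(ltW h0)//.
    by rewrite (le_trans (enorm_cproj _ _)).
  by split; rewrite cprojD (le_trans (enormD _ _))// -lerBrDl (le_trans (hv _)).
have I1 := FL _ _ Dp hm i; have I2 := FL _ _ Dph hm i.
have {}H1 := H1 h; have {}H2 := H2 h; rewrite hh in H1 H2.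
have {}H1 := H1 h1; have {}H2 := H2 h2.
pose k := (F (p + h *: v + m) - F (p + h *: v)) i ord0 - (F (p + m) - F p) i ord0.
have kint : k \is a Num.int.
  rewrite /k; move: I1 I2; case: ifP => _ I1 I2; first by rewrite rpredB.
  by rewrite I1 I2 subrr.
have E : k - h * (l1 - l2) = (F (p + m + h *: v) i ord0 - F (p + m) i ord0 - h *: l1)
   - (F (p + h *: v) i ord0 - F p i ord0 - h *: l2).
  by rewrite /k (addrAC p m) !mxE /GRing.scale/=; ring.
have kl : `|k - h * (l1 - l2)| <= e * h.
  rewrite E (le_trans (ler_normB _ _))//.
  by rewrite (_ : e * h = e / 2 * h + e / 2 * h) ?lerD// -mulrDl -splitr.
have k0 : k = 0.
  apply/eqP; apply: contraT => k0; have := norm_intr_ge1 kint k0.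
  have : `|k| <= e * h + h * `|l1 - l2|.
    rewrite -{1}(subrK (h * (l1 - l2)) k) (le_trans (ler_normD _ _))// lerD//.
    by rewrite normrM hh.
  move: h4; rewrite -[X in _ <= X]div1r ler_pdivlMr ?mulr_gt0// /K => h4.
  have : h * 2 > 0 by rewrite mulr_gt0.
  rewrite (_ : h * _ = 2 * (e * h + h * `|l1 - l2|) + h * 2) in h4; last by ring.
  move: h4; clear; lra.
move: kl; rewrite k0 sub0r normrN normrM hh mulrC.
by rewrite ler_pM2r.
Qed.

(** Compactness bounds the entries over a bounded piece of D containing representatives modulo
    translations; periodicity carries the bound to |x|, |y| < r, and continuity of the Jacobian to
    the boundary. *)
Lemma Jac_bounded : 0 < r -> C1_on U F -> Dom r `<=` U -> is_lift r F ->
  exists2 B : R, 0 <= B & forall p, Dom r p -> forall i j, `|Jac F p i j| <= B.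
Proof.
move=> r0 HC DU FL; have [_ cJ _] := HC.
(* The radius has room for lambda-coordinates of size at most 1/2, bounded by 1 each, and for x and
   y of norm at most r. *)
pose C0 := [set p : V | Dom r p /\ enorm p <= (c + u + s)%:R + 2 * r].
have cC0 : compact C0.
  apply: (@closed_bounded_compact _ _ _ ((c + u + s)%:R + 2 * r)); last by move=> v [].
  apply: closedI; first exact: closed_Dom.
  by apply: closed_enorm_le => x; exact: cvg_id.
have C00 : C0 0.
  split; first by split; rewrite cproj0 enorm0 ltW.
  by rewrite enorm0 addr_ge0// mulr_ge0// ltW.
have /choice [B HB] : forall ij : 'I_(c + u + s) * 'I_(c + u + s), exists B : R,
    forall p, C0 p -> `|Jac F p ij.1 ij.2| <= B.
  move=> [i j]; have [|||p pC Hp] := @compact_EVT_max _ R (fun p => `|Jac F p i j|) C0.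
  - by exists 0.
  - exact: cC0.
  - apply/continuous_in_subspaceT => p /set_mem [Dp _].
    have C := cJ p i j (DU _ Dp).
    exact: (continuous_abs_at C).
  by exists (`|Jac F p i j|) => q Cq; apply: Hp; exact/mem_set.
have B0 ij : 0 <= B ij by apply: le_trans (HB ij 0 C00).
have B1 ij : B ij <= \sum_ij B ij by rewrite (bigD1 ij)//= lerDl sumr_ge0.
exists (\sum_ij B ij); first by rewrite sumr_ge0.
have inter p : enorm (cproj isX p) < r -> enorm (cproj isY p) < r ->
    forall i j, `|Jac F p i j| <= \sum_ij B ij.
  move=> px py i j.
  have Dp : Dom r p by split; exact: ltW.
  have [m [hm hs _]] := tdist_attained isL p.
  rewrite -(Jac_periodic_interior HC DU FL hm px py).
  apply: (le_trans _ (B1 (i, j))); apply: (HB (i, j)).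
  have [Dx Dy] := Dom_shift Dp hm; split=> //.
  rewrite (_ : _ + 2 * r = (c + u + s)%:R + r + r); last by ring.
  rewrite (le_trans (enorm_LX_Y _))// lerD//.
  have -> : cproj isLX (p + m) = cproj isL (p + m) + cproj isX (p + m).
    apply/matrixP => k l; rewrite !mxE /isLX /isX /isL.
    case: (ltnP k c) => kc; rewrite ?addr0 ?add0r//.
    by rewrite (leq_trans kc (leq_addr _ _)).
  rewrite (le_trans (enormD _ _))// lerD// (le_trans (enorm_le_sum _))//.
  rewrite -[leRHS](_ : \sum_(k < c + u + s) (1 : R) = _); last first.
    by rewrite sumr_const card_ord.
  rewrite ler_sum// => k _; rewrite mxE; case: (boolP (isL k)) => [/hs|_].
    by move=> h; rewrite (le_trans h)// invf_le1// ler1n.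
  by rewrite normr0.
move=> p Dp i j; rewrite leNgt; apply/negP => pB.
have gap : 0 < `|Jac F p i j| - \sum_ij B ij by rewrite subr_gt0.
have /cvgrPdist_lt /(_ _ gap) := cJ p i j (DU _ Dp).
move=> /nbhs_ballP[d d0 Hd].
(* p - t w scales x and y by 1 - t and keeps lambda: an interior point so close to p that the excess
   over the bound survives. *)
pose w := cproj isX p + cproj isY p.
pose t := Num.min 1 (d / (2 * (`|w| + 1))).
have w1 : 0 < `|w| + 1 by rewrite ltr_wpDl.
have t0 : 0 < t by rewrite lt_min ltr01 divr_gt0// mulr_gt0.
have t1 : t <= 1 by rewrite /t ge_min lexx.
have td : t * `|w| < d.
  have : t <= d / (2 * (`|w| + 1)) by rewrite /t ge_min lexx orbT.
  rewrite ler_pdivlMr ?mulr_gt0// => h.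
  by have := mulr_ge0 (ltW t0) (normr_ge0 w); rewrite /= in d0; lra.
have XY : cproj isX (cproj isY p) = 0 /\ cproj isY (cproj isX p) = 0.
  split; apply: cproj_disjoint => k; last exact: isY_isX.
  by apply: contraL; exact: isY_isX.
have shr (P : pred 'I_(c + u + s)) : cproj P w = cproj P p -> enorm (cproj P p) <= r ->
    enorm (cproj P (p - t *: w)) < r.
  move=> E h; rewrite cprojB cprojZ E -{1}[cproj P p]scale1r -scalerBl enormZ.
  rewrite ger0_norm ?subr_ge0// (le_lt_trans (ler_wpM2l _ h)) ?subr_ge0//.
  by rewrite mulrBl mul1r gtrBl mulr_gt0.
have [Dx Dy] := Dp.
have [EX EY] : cproj isX w = cproj isX p /\ cproj isY w = cproj isY p.
  by rewrite /w !cprojD !cprojK XY.1 XY.2 addr0 add0r.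
have := Hd (p - t *: w); rewrite -ball_normE /ball_ /= opprB addrC subrK.
rewrite normrZ (ger0_norm (ltW t0)) => /(_ td).
move=> h2; have := ler_normD (Jac F p i j - Jac F (p - t *: w) i j) (Jac F (p - t *: w) i j).
rewrite subrK leNgt => /negP; apply.
rewrite -[ltRHS](subrK (\sum_ij B ij)); apply: ltr_leD; first exact: h2.
by apply: inter; [exact: shr EX Dx|exact: shr EY Dy].
Qed.

End JacobianBounds.

(** * Mean value estimates on D *)

Section Expansion.
Variables (R : realType) (c u s : nat).
Local Notation V := 'cV[R]_(c + u + s).
Variables (r B : R) (U : set V) (F : V -> V).
Hypothesis F_C1 : C1_on U F.
Hypothesis Dom_U : Dom r `<=` U.
Hypothesis Jac_le : forall p, Dom r p -> forall i j, `|Jac F p i j| <= B.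

(** The two ingredients of the expansion rates: xi is [min_expansion] minus 1/M times [shear_bound],
    and xi_{cu,1,P} is the same with L in place of 1/M. *)
Definition min_expansion : R := infD r (fun z => bmI F isLX isLX (Pset r z)).
Definition shear_bound : R := supD r (fun p => bnorm isLX isY (Jac F p)).

Lemma MVT_dot p v e : Dom r p -> Dom r (p + v) ->
  exists2 t : R, 0 <= t <= 1 &
    dot e (F (p + v) - F p) = dot e (Jac F (p + t *: v) *m v).
Proof.
move=> Dp Dpv; have [_ _ dF] := F_C1.
have [t t01|t t01 E] := @MVT_line R _ (fun q => dot e (F q)) p v
    (fun q => dot e (Jac F q *m v)).
  have D := is_derive_mx F (p + t *: v) v (Jac F (p + t *: v) *m v).
  have {D} /D.1 D := dF _ v (Dom_U (Dom_convex Dp Dpv t01)).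
  rewrite /dot (_ : (fun q => _) = \sum_i (e i ord0 *: (fun q => F q i ord0))).
    by apply: is_derive_sum => i; exact: is_deriveZ.
  by apply/funext => q; rewrite fct_sumE.
by exists t => //; rewrite dotDr dotNr.
Qed.

Lemma dot_cproj (P : pred 'I_(c + u + s)) (v w : V) :
  dot (cproj P v) w = dot (cproj P v) (cproj P w).
Proof. by apply: eq_bigr => i _; rewrite !mxE; case: (P i); rewrite ?mul0r. Qed.

(** The scalar mean value theorem is applied in the direction of the projected increment itself;
    Cauchy-Schwarz then gives one point q for the whole block. *)
Lemma MVT_block P p v : Dom r p -> Dom r (p + v) ->
  exists2 q, Dom r q &
    enorm (cproj P (F (p + v) - F p)) <= enorm (cproj P (Jac F q *m v)).
Proof.
move=> Dp Dpv; have [t t01 E] := MVT_dot (cproj P (F (p + v) - F p)) Dp Dpv.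
exists (p + t *: v); first exact: Dom_convex.
have := cauchy_schwarz (cproj P (F (p + v) - F p)) (cproj P (Jac F (p + t *: v) *m v)).
rewrite -dot_cproj -E dot_cproj -sqr_enorm expr2.
have [->|w0] := eqVneq (enorm (cproj P (F (p + v) - F p))) 0; first by rewrite enorm_ge0.
by rewrite ler_pM2l// lt_def w0 enorm_ge0.
Qed.

Lemma bnorm_le_bound I J p : Dom r p ->
  bnorm I J (Jac F p) <= \sum_(i < c + u + s) \sum_(j < c + u + s) B.
Proof.
move=> Dp; rewrite (le_trans (bnorm_le _ _ _))// ler_sum// => i _.
by rewrite ler_sum// => j _; exact: Jac_le.
Qed.

Lemma le_supD (g : V -> R) K p : (forall q, Dom r q -> g q <= K) -> Dom r p ->
  g p <= supD r g.
Proof.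
move=> gK Dp; apply: ub_le_sup; last by exists p.
by exists K => _ [q Dq <-]; exact: gK.
Qed.

Lemma infD_le (g : V -> R) p : (forall q, 0 <= g q) -> Dom r p -> infD r g <= g p.
Proof.
by move=> g0 Dp; apply: ge_inf; [exists 0 => _ [q _ <-]|exists p].
Qed.

Lemma lipschitz_Dom : exists2 C : R, 0 < C & forall p v, Dom r p -> Dom r (p + v) ->
  enorm (F (p + v) - F p) <= C * enorm v.
Proof.
exists (`|\sum_(i < c + u + s) \sum_(j < c + u + s) B| + 1); first by rewrite ltr_wpDl.
have cT (v : V) : cproj xpredT v = v by apply/matrixP => i j; rewrite mxE (ord1 j).
move=> p v Dp Dpv; have [q Dq] := MVT_block xpredT Dp Dpv.
rewrite !cT => /le_trans; apply; rewrite (le_trans (enorm_mulmx _ _))//.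
rewrite ler_wpM2r ?enorm_ge0// ler_wpDr// (le_trans _ (ler_norm _))//.
by rewrite ler_sum// => i _; rewrite ler_sum// => j _; exact: Jac_le.
Qed.

Lemma MVT_Y p v : Dom r p -> Dom r (p + v) ->
  exists a b : R, [/\ 0 <= a, 0 <= b,
    (forall k, 0 <= k -> a + k * b <=
       supD r (fun q => bnorm isY isY (Jac F q) + k * bnorm isY isLX (Jac F q))) &
    enorm (cproj isY (F (p + v) - F p)) <=
      a * enorm (cproj isY v) + b * enorm (cproj isLX v)].
Proof.
move=> Dp Dpv; have [q Dq H] := MVT_block isY Dp Dpv.
exists (bnorm isY isY (Jac F q)), (bnorm isY isLX (Jac F q)).
split; rewrite ?bnorm_ge0//.
  move=> k k0.
  apply: (@le_supD (fun q => bnorm isY isY (Jac F q) + k * bnorm isY isLX (Jac F q))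
    (\sum_(i < c + u + s) \sum_(j < c + u + s) B +
     k * \sum_(i < c + u + s) \sum_(j < c + u + s) B)) => // q' Dq'.
  by rewrite lerD ?ler_wpM2l// bnorm_le_bound.
rewrite (le_trans H)// {1}(cproj_LX_Y v) mulmxDr cprojD addrC.
by rewrite (le_trans (enormD _ _))// lerD// enorm_block_le.
Qed.

Lemma shear_bound_ge0 : 0 <= r -> 0 <= shear_bound.
Proof.
move=> r0; have D0 : Dom r (0 : V) by split; rewrite cproj0 enorm0.
apply: le_trans (bnorm_ge0 isLX isY (Jac F 0)) _.
by apply: (le_supD (fun q Dq => bnorm_le_bound isLX isY Dq)).
Qed.

Lemma shear_le p v : Dom r p -> Dom r (p + v) -> cproj isY v = v ->
  enorm (cproj isLX (F (p + v) - F p)) <= shear_bound * enorm v.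
Proof.
move=> Dp Dpv Yv; have [q Dq H] := MVT_block isLX Dp Dpv.
rewrite (le_trans H)// -Yv (le_trans (enorm_block_le _ _ _ _))//.
rewrite ler_wpM2r ?enorm_ge0//.
by apply: (le_supD (fun q Dq => bnorm_le_bound isLX isY Dq)).
Qed.

Lemma bmI_ge0 I J (W : set V) : 0 <= bmI F I J W.
Proof. by apply: inf_ge0 => _ [A _ <-]; exact: bm_ge0. Qed.

(** Each entry of A may come from its own point of W, as in the row-wise mean value theorem; the
    bound B makes the entrywise infimum and supremum genuine. *)
Lemma bmI_le I J (W : set V) (A : 'M[R]_(c + u + s)) : W `<=` Dom r ->
  (forall i j, exists2 w, W w & A i j = Jac F w i j) -> bmI F I J W <= bm I J A.
Proof.
move=> WD HA; apply: ge_inf; first by exists 0 => _ [A' _ <-]; exact: bm_ge0.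
exists A => // i j _ _; have [w Ww ->] := HA i j; apply/andP; split.
  apply: ge_inf; last by exists w.
  exists (- B) => _ [w' /WD Dw' <-].
  by have := Jac_le Dw' i j; rewrite ler_norml => /andP[].
apply: ub_le_sup; last by exists w.
exists B => _ [w' /WD Dw' <-].
by have := Jac_le Dw' i j; rewrite ler_norml => /andP[].
Qed.

Lemma min_expansion_le_bm p : Dom r p -> min_expansion <= bm isLX isLX (Jac F p).
Proof.
move=> Dp; apply: (le_trans (infD_le (fun q => bmI_ge0 _ _ _) Dp)).
apply: bmI_le => [w []//|i j]; exists p => //; split => //.
by rewrite subrr (le_trans (tdist_le0 _ _))// cproj0 enorm0 divr_ge0 ?invr_ge0.
Qed.

(* The row-wise mean value theorem puts the averaged matrix in the interval
   matrix over P(midpoint), since the segment stays within R_Lambda/2 of it. *)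
Lemma expansion_LX p v : Dom r p -> Dom r (p + v) -> cproj isLX v = v ->
  enorm (cproj isL v) <= 2^-1 ->
  min_expansion * enorm v <= enorm (cproj isLX (F (p + v) - F p)).
Proof.
move=> Dp Dpv LXv vL; have [_ _ dF] := F_C1.
have /choice [t Ht] : forall i, exists t : R, 0 <= t <= 1 /\
    F (p + v) i ord0 - F p i ord0 = (Jac F (p + t *: v) *m v) i ord0.
  move=> i; have [t t01|t t01 E] := @MVT_line R _ (fun q => F q i ord0) p v
      (fun q => (Jac F q *m v) i ord0).
    by move: i; apply/is_derive_mx; apply: dF; apply/Dom_U/Dom_convex.
  by exists t.
pose A : 'M[R]_(c + u + s) := \matrix_(i, j) Jac F (p + t i *: v) i j.
have -> : F (p + v) - F p = A *m v.
  apply/matrixP => i j; rewrite (ord1 j) [LHS]mxE [X in _ + X]mxE (Ht i).2.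
  by rewrite [LHS]mxE [RHS]mxE; apply: eq_bigr => k _; rewrite [A i k]mxE.
have := bm_le_enorm_block isLX isLX A v; rewrite LXv; apply: le_trans.
rewrite ler_wpM2r ?enorm_ge0//.
have h01 : 0 <= (2^-1 : R) <= 1 by rewrite invr_ge0 ler0n/= invf_le1// ler1n.
have Dm : Dom r (p + 2^-1 *: v) by exact: Dom_convex.
apply: (le_trans (infD_le (fun q => bmI_ge0 _ _ _) Dm)).
apply: bmI_le => [w []//|i j]; exists (p + t i *: v); last by rewrite mxE.
have [t01 _] := Ht i; split; first exact: Dom_convex.
rewrite opprD addrACA subrr add0r -scalerBl (le_trans (tdist_le0 _ _))//.
rewrite cprojZ enormZ /RL.
have th : `|t i - 2^-1| <= 2^-1 by case/andP: t01 => t0 t1; rewrite ler_norml; lra.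
by rewrite (_ : 2^-1 / 2 = 2^-1 * 2^-1)// ler_pM ?enorm_ge0.
Qed.

(** The increment is split at the corner q: the y-leg costs at most the shear, and the (lambda,
    x)-leg expands. The corner lies in D because x and y are bounded separately. *)
Lemma expansion p v : Dom r p -> Dom r (p + v) -> enorm (cproj isL v) <= 2^-1 ->
  min_expansion * enorm (cproj isLX v) - shear_bound * enorm (cproj isY v) <=
    enorm (cproj isLX (F (p + v) - F p)).
Proof.
move=> Dp Dpv vL; pose q := p + cproj isY v.
have Eq : p + v = q + cproj isLX v by rewrite {1}(cproj_LX_Y v) addrA addrAC.
have XY : cproj isX (cproj isY v) = 0.
  by apply: cproj_disjoint => i; apply: contraL; exact: isY_isX.
have Dq : Dom r q.
  by apply: (Dom_split Dp Dpv); rewrite !cprojD ?XY ?addr0// cprojK.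
have E1 := shear_le Dp Dq (cprojK _ _).
rewrite -/q in E1.
have := @expansion_LX q (cproj isLX v) Dq; rewrite -Eq cprojK cproj_sub_id//; last first.
  exact: isL_isLX.
move=> /(_ Dpv erefl vL) E2.
rewrite lerBlDr (le_trans E2)//.
have -> : F (p + v) - F q = (F (p + v) - F p) - (F q - F p).
  by rewrite opprB addrA subrK.
rewrite cprojB (le_trans (enormD _ _))// enormN lerD//.
Qed.

End Expansion.

(** * Solving locally for the (lambda, x)-part of the image *)

Section LocalContinuation.
Variables (R : realType) (c u s : nat).
Local Notation V := 'cV[R]_(c + u + s).
Variables (r B : R) (U : set V) (F : V -> V).
Hypothesis F_C1 : C1_on U F.
Hypothesis Dom_U : Dom r `<=` U.
Hypothesis Jac_le : forall p, Dom r p -> forall i j, `|Jac F p i j| <= B.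

(** Positive minimal expansion makes the block injective. Completed by the identity on the
    y-coordinates it is a square matrix A', hence invertible. *)
Lemma block_LX_onto (A : 'M[R]_(c + u + s)) (g : V) : 0 < bm isLX isLX A ->
  cproj isLX g = g -> exists2 h : V, cproj isLX h = h & cproj isLX (A *m h) = g.
Proof.
move=> m0 LXg.
pose A' : 'M[R]_(c + u + s) := \matrix_(i, j)
  (if isLX i then (if isLX j then A i j else 0) else (i == j)%:R).
have A'E v : A' *m v = cproj isLX (A *m cproj isLX v) + cproj isY v.
  apply/matrixP => i j; rewrite (ord1 j) !mxE isLX_isY.
  have [iLX|iY] := boolP (isLX i).
    rewrite addr0; apply: eq_bigr => k _; rewrite !mxE iLX.
    by case: ifP; rewrite ?mul0r ?mulr0.
  rewrite add0r (bigD1 i)//= big1 => [|k ki]; rewrite !mxE (negPf iY).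
    by rewrite eqxx mul1r addr0.
  by rewrite eq_sym (negPf ki) mul0r.
have unitA' : A' \in unitmx.
  rewrite unitmxE unitfE -det_tr; apply/det0P => -[v v0 /(congr1 trmx)].
  rewrite trmx_mul trmxK trmx0 A'E => E.
  have EL : cproj isLX v^T = 0.
    apply: enorm_eq0; apply/eqP; rewrite eq_le enorm_ge0 andbT -(pmulr_rle0 _ m0).
    apply: (le_trans (bm_le_enorm_block _ _ _ _)).
    move/(congr1 (cproj isLX)): E; rewrite cprojD cprojK cproj0.
    rewrite (@cproj_disjoint _ _ _ _ isLX isY) ?addr0 => [->|i]; first by rewrite enorm0.
    by rewrite isLX_isY negbK.
  have EY : cproj isY v^T = 0.
    by move: E; rewrite EL mulmx0 cproj0 add0r.
  have : v^T = 0 by rewrite (cproj_LX_Y v^T) EL EY addr0.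
  by move/(congr1 trmx); rewrite trmxK trmx0; exact/eqP.
have := A'E (invmx A' *m g); rewrite mulKVmx// => E.
exists (cproj isLX (invmx A' *m g)); first exact: cprojK.
rewrite -[RHS]LXg {2}E cprojD cprojK (@cproj_disjoint _ _ _ _ isLX isY) ?addr0// => i.
by rewrite isLX_isY negbK.
Qed.

(* Minimize [|residual| + (m/2) |xi|] over a small ball: as [m/2] is below the
   expansion of the LX-block, a Newton direction decreases it strictly as long
   as the residual is non-zero. *)
Lemma local_continuation p w tau rho : 0 < min_expansion r F ->
  Dom r p -> enorm (cproj isX p) < r -> cproj isY w = w -> cproj isLX tau = tau ->
  0 < rho ->
  exists2 d0 : R, 0 < d0 & forall d, 0 < d <= d0 -> enorm (cproj isY (p + d *: w)) <= r ->
    exists z, [/\ Dom r z, enorm (z - p) <= rho,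
      cproj isY z = cproj isY (p + d *: w) &
      cproj isLX (F z) = cproj isLX (F p) + d *: tau].
Proof.
move=> m0 Dp px Yw LXtau rho0; have [cF _ dF] := F_C1.
set m := min_expansion r F in m0.
have [C C0 HC] := lipschitz_Dom F_C1 Dom_U Jac_le.
(* z - p will be a sum of two vectors of norm at most rho1, and the second bound keeps x inside
   D. *)
have [rho1 r10 [r1rho r1x]] : exists2 rho1 : R, 0 < rho1 &
    2 * rho1 <= rho /\ rho1 <= r - enorm (cproj isX p).
  have h : 0 < r - enorm (cproj isX p) by rewrite subr_gt0.
  exists (Num.min (rho / 2) (r - enorm (cproj isX p))).
    by rewrite lt_min h divr_gt0.
  split; last by rewrite ge_min lexx orbT.
  by rewrite mulrC -ler_pdivlMr// ge_min lexx.
(* The residual at x = 0 is at most d C'. The bound on d makes this at most (m/2)(rho1/2), so the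
   minimiser has norm at most rho1/2 and leaves room for a further step. *)
pose C' := C * enorm w + enorm tau + 1.
have C'0 : 0 < C' by rewrite ltr_wpDl// addr_ge0 ?mulr_ge0 ?enorm_ge0// ltW.
have w0 : 0 < enorm w + 1 by rewrite ltr_wpDl// enorm_ge0.
exists (Num.min (rho1 / (enorm w + 1)) ((m / 2) * (rho1 / 2) / C')).
  by rewrite lt_min !divr_gt0// mulr_gt0// divr_gt0.
move=> d /andP[dp]; rewrite le_min => /andP[d1 d2] py.
have dw : enorm (d *: w) <= rho1.
  rewrite enormZ (ger0_norm (ltW dp)).
  rewrite ler_pdivlMr// mulrDr in d1.
  by apply: le_trans d1; rewrite lerDl mulr1 ltW.
pose K := [set x : V | cproj isLX x = x /\ enorm x <= rho1].
have DK x : K x -> Dom r (p + d *: w + x).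
  move=> [LXx xr]; split; rewrite cprojD.
    have -> : cproj isX (p + d *: w) = cproj isX p.
      rewrite cprojD cprojZ -Yw cproj_disjoint ?scaler0 ?addr0// => i.
      by apply: contraL; exact: isY_isX.
    rewrite (le_trans (enormD _ _))// -lerBrDl (le_trans _ r1x)//.
    by rewrite (le_trans (enorm_cproj _ _)).
  rewrite -LXx [X in _ + X]cproj_disjoint ?addr0// => i.
  by rewrite isLX_isY.
have D0w : Dom r (p + d *: w).
  rewrite -[_ + _]addr0; apply: DK; split; rewrite ?cproj0 ?enorm0//.
  exact: ltW.
pose G x := cproj isLX (F (p + d *: w + x) - F p) - d *: tau.
pose phi x := enorm (G x) + m / 2 * enorm x.
have cK : compact K.
  apply: (@closed_bounded_compact _ _ _ rho1) => [|x []//].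
  have -> : K = [set x : V | enorm (cproj isLX x - x) <= 0] `&` [set x : V | enorm x <= rho1].
    apply/seteqP; split => x [/= h1 h2]; split => //=; first by rewrite h1 subrr enorm0.
    by apply/eqP; rewrite -subr_eq0; apply/eqP/enorm_eq0/eqP; rewrite eq_le h1 enorm_ge0.
  apply: closedI; apply: closed_enorm_le => x; last exact: cvg_id.
  by apply: continuousB; [exact: continuous_cproj|exact: cvg_id].
have K0 : K 0 by split; rewrite ?cproj0 ?enorm0// ltW.
have cphi : {within K, continuous phi}.
  apply/continuous_in_subspaceT => x /set_mem Kx.
  have cd : {for x, continuous (fun y : V => p + d *: w + y)}.
    apply: (@lipschitz_continuous _ _ _ 1 (fun y : V => p + d *: w + y)) => y y'.
    by rewrite mul1r opprD addrACA subrr add0r.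
  have cFd : {for x, continuous (fun y : V => F (p + d *: w + y))}.
    by apply: (continuous_comp cd); apply: cF; exact/Dom_U/DK.
  have cG : {for x, continuous G}.
    apply: continuous_subc_at; apply: (continuous_comp (continuous_subc_at cFd)).
    exact: continuous_cproj.
  apply: (continuous_add_at (continuous_enorm_comp cG)).
  exact/continuous_mulrc_at/continuous_enorm.
have [|x0 /set_mem [LXx0 x0r] x0min] := compact_EVT_min _ cK cphi; first by exists 0.
have {}x0min x : K x -> phi x0 <= phi x by move=> Kx; apply: x0min; exact/mem_set.
have m2 : 0 < m / 2 by rewrite divr_gt0.
have x0lt : enorm x0 < rho1.
  have h1 : m / 2 * enorm x0 <= d * C'.
    apply: (@le_trans _ _ (phi x0)); first by rewrite lerDr enorm_ge0.
    rewrite (le_trans (x0min _ K0))// /phi enorm0 mulr0 addr0 /G addr0.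
    rewrite (le_trans (enormD _ _))// enormN enormZ (ger0_norm (ltW dp)).
    have h2 := HC _ _ Dp D0w; rewrite enormZ (ger0_norm (ltW dp)) in h2.
    rewrite /C' mulrDr mulr1 ler_wpDr ?(ltW dp)// mulrDr lerD2r.
    by rewrite (le_trans (enorm_cproj _ _))// mulrCA.
  have h2 : d * C' <= m / 2 * (rho1 / 2) by rewrite -ler_pdivlMr.
  have : enorm x0 <= rho1 / 2 by rewrite -(ler_pM2l m2) (le_trans h1).
  by move/le_lt_trans; apply; rewrite ltr_pdivrMr// ltr_pMr// ltr1n.
pose z0 := p + d *: w + x0.
have Dz0 : Dom r z0 by exact: DK.
suff G0 : G x0 = 0.
  exists z0; split => //.
  - have -> : z0 - p = d *: w + x0 by rewrite /z0 addrAC (addrC p) addrK.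
    rewrite (le_trans (enormD _ _))//.
    by rewrite (le_trans _ r1rho)// mulr_natl mulr2n lerD.
  - rewrite /z0 cprojD -LXx0 cproj_disjoint ?addr0// => i.
    by rewrite isLX_isY.
  - by move/eqP: G0; rewrite /G cprojB -addrA -opprD subr_eq0 => /eqP.
apply/enorm_eq0/eqP; rewrite eq_le enorm_ge0 andbT leNgt; apply/negP => g0.
set g := enorm (G x0) in g0.
have LXG : cproj isLX (- G x0) = - G x0.
  by rewrite cprojN /G (cprojB _ (cproj _ _)) cprojK cprojZ LXtau.
have mb := min_expansion_le_bm Jac_le Dz0.
have [h LXh Ah] := block_LX_onto (lt_le_trans m0 mb) LXG.
have hg : m * enorm h <= g.
  have := bm_le_enorm_block isLX isLX (Jac F z0) h.
  rewrite LXh Ah enormN -/g; apply: le_trans.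
  by rewrite ler_wpM2r ?enorm_ge0.
have n0 : 0 < (c + u + s)%:R + 1 :> R by rewrite ltr_wpDl.
(* Budget of a step t along h: the residual loses t g, the linearisation error costs at most t g/4,
   and (m/2)|x| grows by at most t g/2 since m |h| <= g. A decrease by t g/4 remains. *)
have e0 : 0 < g / (4 * ((c + u + s)%:R + 1)) by rewrite divr_gt0// mulr_gt0.
have [t1 t10 Ht1] := (is_derive_eps _ _ _ _).1 (dF z0 h (Dom_U Dz0)) _ e0.
have h1 : 0 < enorm h + 1 by rewrite ltr_wpDl// enorm_ge0.
have [t [tp tt1 t_le1 th]] : exists t : R, [/\ 0 < t, t <= t1, t <= 1 & t * enorm h <= rho1 - enorm x0].
  have gap : 0 < rho1 - enorm x0 by rewrite subr_gt0.
  exists (Num.min (Num.min t1 1) ((rho1 - enorm x0) / (enorm h + 1))); split.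
  - by rewrite !lt_min t10 ltr01 divr_gt0.
  - by rewrite !ge_min lexx.
  - by rewrite !ge_min lexx orbT.
  - apply: (@le_trans _ _ ((rho1 - enorm x0) / (enorm h + 1) * enorm h)).
      by rewrite ler_wpM2r ?enorm_ge0// ge_min lexx orbT.
    by rewrite mulrAC ler_pdivrMr// ler_pM2l// lerDl.
have Kx : K (x0 + t *: h).
  split; first by rewrite cprojD cprojZ LXx0 LXh.
  rewrite (le_trans (enormD _ _))// enormZ (ger0_norm (ltW tp)).
  by rewrite -lerBrDl.
have {}Ht1 := Ht1 t; rewrite (ger0_norm (ltW tp)) in Ht1; have {}Ht1 := Ht1 tt1.
have GE : G (x0 + t *: h) = (1 - t) *: G x0 +
    cproj isLX (F (z0 + t *: h) - F z0 - t *: (Jac F z0 *m h)).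
  rewrite (cprojB _ _ (t *: _)) cprojZ Ah /G !cprojB addrA -/z0.
  move: (cproj _ _) (cproj _ _) (cproj _ _) => f1 f2 f3.
  by apply/matrixP => i j; rewrite !mxE; ring.
have := x0min _ Kx; apply/negP; rewrite -ltNge /phi.
rewrite GE -/g.
have tl1 : 0 <= 1 - t by rewrite subr_ge0.
have a1 : enorm (cproj isLX (F (z0 + t *: h) - F z0 - t *: (Jac F z0 *m h))) <= t * (g / 4).
  rewrite (le_trans (enorm_cproj _ _))// (le_trans (enorm_le_norm _))//.
  apply: le_trans (ler_wpM2l (ler0n _ _) Ht1) _.
  rewrite (mulrA _ (g / _)) (mulrC _ t) ler_wpM2l ?(ltW tp)//.
  rewrite (mulrA _ g) ler_pdivrMr ?mulr_gt0// (mulrA (g / 4)) divfK// mulrC ler_wpM2l ?(ltW g0)//.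
  by rewrite lerDl.
have a2 : m / 2 * enorm (x0 + t *: h) <= m / 2 * enorm x0 + t * (g / 2).
  rewrite (le_trans (ler_wpM2l (ltW m2) (enormD _ _)))// mulrDr lerD2l.
  rewrite enormZ (ger0_norm (ltW tp)) mulrCA ler_wpM2l ?(ltW tp)//.
  by rewrite mulrAC ler_wpM2r// ?invr_ge0.
rewrite (le_lt_trans (lerD (le_trans (enormD _ _) (lerD (lexx _) a1)) a2))//.
rewrite enormZ (ger0_norm tl1) -/g.
have := mulr_gt0 tp g0; clear; lra.
Qed.


End LocalContinuation.

(** Continuity is asked only at points of K: F is known to be continuous only around D, so
    conditions on F must be imposed inside a closed set. *)
Lemma closed_sublevel (T : topologicalType) (R : realType) (K : set T) (g : T -> R) b :
  closed K -> (forall p, K p -> {for p, continuous g}) ->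
  closed (K `&` [set p | g p <= b]).
Proof.
move=> cK cg p clp.
have Kp : K p by apply: cK => W /clp [q [[Kq _] Wq]]; exists q.
split=> //=; rewrite leNgt; apply/negP => gp.
have /clp [q [[_ /= qb] /=]] : nbhs p (g @^-1` [set a | b < a]).
  by apply: (cg _ Kp); exact: lt_nbhsr.
by rewrite ltNge qb.
Qed.

(** * Continuation of lifts along a path in D *)

Section Continuation.
Variables (R : realType) (c u s : nat).
Local Notation V := 'cV[R]_(c + u + s).
Variables (r L B : R) (U : set V) (F : V -> V).
Hypothesis r_gt0 : 0 < r.
Hypothesis L_gt0 : 0 < L.
Hypothesis r_L : 2 * r / L < 2^-1.
Hypothesis F_C1 : C1_on U F.
Hypothesis Dom_U : Dom r `<=` U.
Hypothesis Jac_le : forall p, Dom r p -> forall i j, `|Jac F p i j| <= B.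
Hypothesis F_cover : covering_conditions r L F.
Hypothesis F_backward : backward_cone_conditions r L F.
Hypothesis rate : mu_s1 r L F < xi_cu1P r L F.

(** The covering condition at p itself, with homotopy parameter 0. As h_0(p) is always within
    R_Lambda of lambda^* in the lambda-direction, missing D_{lambda^*} amounts to leaving D. *)
Lemma covering_exit p : Dom r p -> enorm (cproj isX p) = r ->
  enorm (cproj isY p) < r -> ~ Dom r (F p).
Proof.
move=> Dp px py [Fx Fy]; have [l [h [A [_ [_ [hL [h0 [hx _]]]]]]]] := F_cover Dp.
have Up : Dom r p /\ Ju_chart p L^-1 p.
  by split=> //; rewrite /Ju_chart /= subrr !cproj0 enorm0 mulr0.
have a01 : 0 <= (0 : R) <= 1 by rewrite lexx ler01.
have hF := h0 _ Up.
apply: (hx 0 p a01 Up _ px py); first by rewrite subrr cproj0 enorm0 invr_ge0.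
by split; rewrite ?(cprojX_shift hF) ?(cprojY_shift hF)//; apply/ltW/hL.
Qed.

Lemma covering_top p : Dom r p -> Dom r (F p) -> enorm (cproj isY (F p)) < r.
Proof.
move=> Dp [Fx Fy]; have [l [h [A [_ [_ [hL [h0 [_ [hy _]]]]]]]]] := F_cover Dp.
have Up : Dom r p /\ Ju_chart p L^-1 p.
  by split=> //; rewrite /Ju_chart /= subrr !cproj0 enorm0 mulr0.
have a01 : 0 <= (0 : R) <= 1 by rewrite lexx ler01.
have hF := h0 _ Up.
rewrite lt_def Fy andbT eq_sym; apply/eqP => E; apply: (hy 0 p a01 Up).
by split; rewrite (cprojY_shift hF)//; split;
  rewrite ?(cprojX_shift hF) ?(cprojY_shift hF)//; apply/ltW/hL.
Qed.

(* If |x| = |y| = r at q, then q is a limit of points with |x| = r, |y| < r, which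
   leave D; so F q has |x| = r as well, and leaves D at the next step. *)
Lemma covering_strict_X q : Dom r q -> Dom r (F q) -> Dom r (F (F q)) ->
  enorm (cproj isX q) < r.
Proof.
move=> Dq DFq DFFq; have [qx qy] := Dq; have [Fx Fy] := DFq.
rewrite lt_def qx andbT eq_sym; apply/eqP => Eqx.
have Fy' := covering_top Dq DFq.
have [Fx'|Fx'] := ltP (enorm (cproj isX (F q))) r; last first.
  by apply: (covering_exit DFq _ Fy') DFFq; apply/eqP; rewrite eq_le Fx.
have [C C0 HC] := lipschitz_Dom F_C1 Dom_U Jac_le.
(* F q is interior to D with margin [gap]. Shrinking y by the factor 1 - e moves the image by at
   most C e r <= gap, so it stays in D although the point is on the exit face. *)
pose gap := Num.min (r - enorm (cproj isX (F q))) (r - enorm (cproj isY (F q))).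
have gap0 : 0 < gap by rewrite /gap lt_min !subr_gt0 Fx' Fy'.
pose e := Num.min 1 (gap / (C * r)).
have e0 : 0 < e by rewrite lt_min ltr01 divr_gt0// mulr_gt0.
have e1 : e <= 1 by rewrite ge_min lexx.
pose v := - (e *: cproj isY q).
have Xv : cproj isX v = 0.
  rewrite cprojN cprojZ cproj_disjoint ?scaler0 ?oppr0// => i.
  by apply: contraL; exact: isY_isX.
have Yv : enorm (cproj isY (q + v)) < r.
  rewrite cprojD cprojN cprojZ cprojK -{1}[cproj isY q]scale1r -scalerBl enormZ.
  rewrite ger0_norm ?subr_ge0// (le_lt_trans (ler_wpM2l _ qy)) ?subr_ge0//.
  by rewrite mulrBl mul1r gtrBl mulr_gt0.
have Xq : enorm (cproj isX (q + v)) = r by rewrite cprojD Xv addr0.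
have Dqv : Dom r (q + v) by split; rewrite ?Xq// ltW.
apply: (covering_exit Dqv Xq Yv).
have Fv : enorm (F (q + v) - F q) <= gap.
  rewrite (le_trans (HC _ _ Dq Dqv))// /v enormN enormZ (ger0_norm (ltW e0)) mulrCA.
  have : e <= gap / (C * r) by rewrite ge_min lexx orbT.
  rewrite ler_pdivlMr ?mulr_gt0//; apply: le_trans.
  by rewrite ler_wpM2l ?(ltW e0)// ler_wpM2l ?(ltW C0).
split; rewrite -(subrK (F q) (F (q + v))) cprojD (le_trans (enormD _ _))// -lerBrDr.
  by rewrite (le_trans (enorm_cproj _ _))// (le_trans Fv)// ge_min lexx.
by rewrite (le_trans (enorm_cproj _ _))// (le_trans Fv)// ge_min lexx orbT.
Qed.

Lemma mu_s1_ge0 : 0 <= mu_s1 r L F.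
Proof.
have D0 : Dom r (0 : V) by split; rewrite cproj0 enorm0 ltW.
have D00 : Dom r (0 + 0 : V) by rewrite addr0.
have [a [b [a0 b0 H _]]] := MVT_Y F_C1 Dom_U Jac_le D0 D00.
have Li : 0 <= L^-1 by rewrite invr_ge0 ltW.
by apply: le_trans (H _ Li); rewrite addr_ge0// mulr_ge0.
Qed.

Let m0 := min_expansion r F.
Let b0 := shear_bound r F.

Lemma min_expansion_gt0 : 0 < m0.
Proof.
have h := le_lt_trans mu_s1_ge0 rate.
have b0_ge0 : 0 <= b0 := shear_bound_ge0 Jac_le (ltW r_gt0).
by rewrite (lt_le_trans h)// gerBl mulr_ge0// ltW.
Qed.

Lemma contraction_Y p v : Dom r p -> Dom r (p + v) ->
  enorm (cproj isLX v) <= L^-1 * enorm (cproj isY v) ->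
  enorm (cproj isY (F (p + v) - F p)) <= mu_s1 r L F * enorm (cproj isY v).
Proof.
move=> Dp Dpv cone; have [a [b [a0 b_0 H E]]] := MVT_Y F_C1 Dom_U Jac_le Dp Dpv.
have Li : 0 <= L^-1 by rewrite invr_ge0 ltW.
rewrite (le_trans E)//.
apply: (@le_trans _ _ ((a + L^-1 * b) * enorm (cproj isY v))).
  by rewrite mulrDl lerD2l (mulrC L^-1) -mulrA ler_wpM2l.
by rewrite ler_wpM2r ?enorm_ge0//; exact: H.
Qed.

(* [tau] is a representative of the (lambda, x)-difference of F (q + v) and F q up
   to integers.  Points over the segment from q to q + v are continued so that
   their images run along tau; the path ends at a point whose image agrees with
   F (q + v) on the torus, so it ends at q + v by the backward cone condition. *)
Section Path.
Variables (q v tau : V).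
Hypothesis Dq : Dom r q.
Hypothesis Da : Dom r (q + v).
Hypothesis DFq : Dom r (F q).
Hypothesis DFa : Dom r (F (q + v)).
Hypothesis qx : enorm (cproj isX q) < r.
Hypothesis cone : enorm (cproj isLX v) <= L^-1 * enorm (cproj isY v).
Hypothesis vY : 0 < enorm (cproj isY v).
Hypothesis LXtau : cproj isLX tau = tau.
Hypothesis tau_shift : shifts (cproj isLX (F (q + v) - F q) - tau).
Hypothesis tau_le : enorm tau <= L^-1 * enorm (cproj isY (F (q + v) - F q)).

Let w := cproj isY v.
Let rho0 := L^-1 * enorm w.
(** Reads the parameter t off a path point. As T is continuous on the whole space, t can be
    maximised over the set of all path points, without a choice of z depending on t. *)
Let T (z : V) := dot w (z - q) / enorm w ^+ 2.

(** The last two bounds are closed conditions that turn out strict, which leaves room to go on. The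
    x-part of F z needs no bound of its own: it lies on the segment between those of F q and F (q +
    v). *)
Let on_path (t : R) (z : V) := [/\ Dom r z, cproj isY (z - q) = t *: w,
  cproj isLX (F z - F q) = t *: tau, enorm (cproj isLX (z - q)) <= rho0 &
  enorm (cproj isY (F z)) <= r].

Let rho0_lt : rho0 < 2^-1.
Proof.
apply: le_lt_trans r_L; rewrite /rho0 mulrC ler_wpM2r ?invr_ge0 ?(ltW L_gt0)//.
have -> : w = cproj isY (q + v) - cproj isY q by rewrite -cprojB addrC addKr.
have [_ h1] := Dq; have [_ h2] := Da.
by rewrite (le_trans (enormD _ _))// enormN mulr_natl mulr2n lerD.
Qed.

Let T_path t z : cproj isY (z - q) = t *: w -> T z = t.
Proof.
move=> E; rewrite /T /w dot_cproj E dotZr -/w -sqr_enorm mulfK// expf_neq0//.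
by rewrite gt_eqF.
Qed.

Let small_lambda z : enorm (cproj isLX (z - q)) <= rho0 ->
  enorm (cproj isL (z - q)) < 2^-1.
Proof.
by move=> h; apply: le_lt_trans rho0_lt; apply: le_trans h; apply: enorm_cproj_sub;
  exact: isL_isLX.
Qed.

Let path_X t z : 0 <= t <= 1 -> on_path t z -> enorm (cproj isX (F z)) <= r.
Proof.
move=> t01 [_ _ E _ _].
have -> : cproj isX (F z) = cproj isX (F q) + t *: cproj isX tau.
  rewrite -cprojZ -E cproj_sub_id; last exact: isX_isLX.
  by rewrite -cprojD addrC subrK.
apply: enorm_convex t01; first by case: DFq.
suff -> : cproj isX (F q) + cproj isX tau = cproj isX (F (q + v)) by case: DFa.
have := cprojX_shift tau_shift.
rewrite cproj_sub_id ?cprojB; last exact: isX_isLX.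
by move=> <-; rewrite addrC subrK.
Qed.

(** Expansion gives m0 times the distance <= t (b0 |w| + |tau|), and contraction in y gives |tau| <=
    mu_{s,1} |w| / L. The right-hand side displays the resulting gap below m0 rho0. *)
Let path_LX t z : 0 <= t <= 1 -> on_path t z ->
  m0 * enorm (cproj isLX (z - q)) <= t * (m0 * rho0 - enorm w * (L^-1 * (xi_cu1P r L F - mu_s1 r L F))).
Proof.
move=> /andP[t0 t1] [Dz EY ELX e _].
have := @expansion R c u s r B U F F_C1 Dom_U Jac_le q (z - q) Dq.
rewrite addrC subrK => /(_ Dz (ltW (small_lambda e))).
rewrite EY ELX !enormZ (ger0_norm t0) -/m0 -/b0.
have : enorm tau <= L^-1 * (mu_s1 r L F * enorm w).
  by rewrite (le_trans tau_le)// ler_wpM2l ?invr_ge0 ?(ltW L_gt0)// contraction_Y.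
have -> : xi_cu1P r L F = m0 - L * b0 by [].
move=> h1 h2; have := ler_wpM2l t0 h1.
have -> : L^-1 * (m0 - L * b0 - mu_s1 r L F) = L^-1 * m0 - b0 - L^-1 * mu_s1 r L F.
  by field; rewrite gt_eqF.
rewrite /rho0; move: h2; lra.
Qed.

Let path_LX_lt t z : 0 <= t <= 1 -> on_path t z -> enorm (cproj isLX (z - q)) < rho0.
Proof.
move=> t01 P; have := path_LX t01 P; have m_gt0 := min_expansion_gt0.
have g : 0 < enorm w * (L^-1 * (xi_cu1P r L F - mu_s1 r L F)).
  by rewrite !mulr_gt0 ?invr_gt0// subr_gt0.
have r0 : 0 < rho0 by rewrite mulr_gt0// invr_gt0.
case/andP: t01 => t0 t1 h; rewrite -(ltr_pM2l m_gt0).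
have [t00|tp] := eqVneq t 0.
  by rewrite (le_lt_trans h)// t00 mul0r mulr_gt0.
have {}tp : 0 < t by rewrite lt_def tp.
have k0 : 0 < m0 * rho0 by rewrite mulr_gt0.
rewrite (le_lt_trans h)//.
apply: (@lt_le_trans _ _ (t * (m0 * rho0))); first by rewrite ltr_pM2l// gtrBl.
by rewrite ler_piMl// ltW.
Qed.

(** For t = 0 the point is q. For 0 < t < 1 strict convexity of the Euclidean ball gives |y| < r, so
    |x| = r would put z on the exit face although F z lies in D. *)
Let path_interior_X t z : 0 <= t < 1 -> on_path t z -> enorm (cproj isX z) < r.
Proof.
move=> /andP[t0 t1] P; have [Dz EY ELX e FY] := P.
have t01 : 0 <= t <= 1 by rewrite t0 ltW.
have [tz|tp] := eqVneq t 0.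
  have m_gt0 := min_expansion_gt0.
  have := path_LX t01 P; rewrite tz mul0r pmulr_rle0// => h.
  have : cproj isLX (z - q) = 0 by apply/enorm_eq0/eqP; rewrite eq_le h enorm_ge0.
  move: EY; rewrite tz scale0r => EY E.
  have : z - q = 0 by rewrite (cproj_LX_Y (z - q)) E EY addr0.
  by move/eqP; rewrite subr_eq0 => /eqP ->.
have [zx zy] := Dz; rewrite lt_def zx andbT eq_sym; apply/eqP => Ezx.
apply: (covering_exit Dz Ezx); last by split=> //; exact: path_X P.
have [_ qy] := Dq; have [_ ay] := Da.
have Ez : cproj isY z = (1 - t) *: cproj isY q + t *: cproj isY (q + v).
  have -> : cproj isY z = cproj isY q + t *: w by rewrite -EY -cprojD addrC subrK.
  rewrite (cprojD _ q) -/w.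
  by apply/matrixP => i j; rewrite !mxE; ring.
rewrite lt_def zy andbT eq_sym; apply/eqP => Ezy.
have sq : enorm (cproj isY z) ^+ 2 = (1 - t) * enorm (cproj isY q) ^+ 2
   + t * enorm (cproj isY (q + v)) ^+ 2 - t * (1 - t) * enorm w ^+ 2.
  rewrite Ez cprojD -/w !sqr_enorm.
  by rewrite !(dotDl, dotDr, dotZl, dotZr) (dotC w); ring.
have h1 : enorm (cproj isY q) ^+ 2 <= r ^+ 2 by rewrite ler_sqr ?nnegrE ?enorm_ge0 ?(ltW r_gt0).
have h2 : enorm (cproj isY (q + v)) ^+ 2 <= r ^+ 2.
  by rewrite ler_sqr ?nnegrE ?enorm_ge0 ?(ltW r_gt0).
have h3 : 0 < t * (1 - t) * enorm w ^+ 2.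
  by rewrite !mulr_gt0 ?exprn_gt0 ?subr_gt0// lt_def tp.
have h4 := ler_wpM2l t0 h2.
have t1' : 0 <= 1 - t by rewrite subr_ge0 ltW.
have h5 := ler_wpM2l t1' h1.
move: sq h3 h4 h5; rewrite Ezy; lra.
Qed.

Let path_step t z : 0 <= t < 1 -> on_path t z ->
  exists2 t' : R, t < t' <= 1 & exists z', on_path t' z'.
Proof.
move=> /andP[t0 t1] P; have [Dz EY ELX e FY] := P.
have t01 : 0 <= t <= 1 by rewrite t0 ltW.
have DFz : Dom r (F z) by split=> //; exact: path_X P.
have e_lt := path_LX_lt t01 P; have FY_lt := covering_top Dz DFz.
have [C C0 HC] := lipschitz_Dom F_C1 Dom_U Jac_le.
have [rho rhop [rho1 rho2]] : exists2 rho : R, 0 < rho &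
    rho <= rho0 - enorm (cproj isLX (z - q)) /\ C * rho <= r - enorm (cproj isY (F z)).
  have h1 : 0 < rho0 - enorm (cproj isLX (z - q)) by rewrite subr_gt0.
  have h2 : 0 < r - enorm (cproj isY (F z)) by rewrite subr_gt0.
  exists (Num.min (rho0 - enorm (cproj isLX (z - q))) ((r - enorm (cproj isY (F z))) / C)).
    by rewrite lt_min h1 divr_gt0.
  split; first by rewrite ge_min lexx.
  by rewrite mulrC -ler_pdivlMr// ge_min lexx orbT.
have t01' : 0 <= t < 1 by rewrite t0.
have [d0 d00 H] := local_continuation F_C1 Dom_U Jac_le min_expansion_gt0 Dz
  (path_interior_X t01' P) (cprojK isY v) LXtau rhop.
pose d := Num.min d0 (1 - t).
have dp : 0 < d by rewrite lt_min d00 subr_gt0.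
have dd0 : 0 < d <= d0 by rewrite dp ge_min lexx.
have dt : t + d <= 1 by rewrite -lerBrDl ge_min lexx orbT.
have Yz : cproj isY (z + d *: w) = cproj isY q + (t + d) *: w.
  rewrite cprojD cprojZ /w cprojK -(subrK q z) cprojD EY -/w scalerDl.
  by rewrite addrA (addrC (t *: w)).
have Yle : enorm (cproj isY (z + d *: w)) <= r.
  rewrite Yz; apply: enorm_convex; [by case: Dq| |by rewrite dt andbT addr_ge0// ltW].
  by rewrite /w -cprojD; case: Da.
have [z' [Dz' zz' Yz' LXz']] := H d dd0 Yle.
exists (t + d); first by rewrite ltrDl dp.
exists z'; split => //.
- by rewrite cprojB Yz' Yz addrC addKr.
- rewrite cprojB LXz' addrAC -cprojB ELX.
  by rewrite scalerDl.
- rewrite -(subrK z z') -addrA cprojD (le_trans (enormD _ _))// -lerBrDr.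
  by rewrite (le_trans (enorm_cproj _ _))// (le_trans zz').
- rewrite -(subrK (F z) (F z')) cprojD (le_trans (enormD _ _))// -lerBrDr.
  rewrite (le_trans _ rho2)// (le_trans (enorm_cproj _ _))//.
  have Ez' : z' = z + (z' - z) by rewrite addrC subrK.
  rewrite {1}Ez' (le_trans (HC _ _ Dz _)) -?Ez'//.
  by rewrite ler_wpM2l// ltW.
Qed.

Lemma path_end : exists z, [/\ Dom r z, cproj isY z = cproj isY (q + v),
  cproj isLX (F z) = cproj isLX (F q) + tau, enorm (cproj isLX (z - q)) <= rho0 &
  enorm (cproj isY (F z)) <= r].
Proof.
have Kc : closed [set z : V | Dom r z /\ enorm (cproj isLX (z - q)) <= rho0].
  apply: closedI; first exact: closed_Dom.
  apply: closed_enorm_le => z; apply: continuous_comp; last exact: continuous_cproj.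
  by apply: continuous_subc_at; exact: cvg_id.
have cT : continuous T.
  have w2 : 0 < enorm w ^+ 2 by rewrite exprn_gt0.
  apply: (@lipschitz_continuous _ _ _ (enorm w * (c + u + s)%:R / enorm w ^+ 2)) => x y.
  have -> : T x - T y = dot w (x - y) / enorm w ^+ 2.
    by rewrite /T -mulrBl; congr (_ / _); rewrite -dotNr -dotDr opprB addrA subrK.
  rewrite normrM (@ger0_norm _ (_ ^-1)) ?invr_ge0 ?(ltW w2)//.
  rewrite (mulrAC _ (_ ^-1)) ler_wpM2r ?invr_ge0 ?(ltW w2)//.
  have h (e : V) : dot w e <= enorm w * (c + u + s)%:R * `|e|.
    rewrite (le_trans (cauchy_schwarz _ _))// -mulrA ler_wpM2l ?enorm_ge0//.
    exact: enorm_le_norm.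
  have h' := h (- (x - y)); rewrite dotNr normrN in h'.
  by rewrite ler_norml lerNl h' h.
have cP (P : pred 'I_(c + u + s)) (f : V -> V) a p : {for p, continuous f} ->
    {for p, continuous (fun z => cproj P (f z - a))}.
  move=> cf; apply: (continuous_comp (continuous_subc_at cf)).
  exact: continuous_cproj.
have cF p : Dom r p -> {for p, continuous F} by case: F_C1 => + _ _ => h /Dom_U /h.
(* K1 to K5 impose the path conditions one after another, equations being written as norms at most
   0. *)
pose K1 := [set z : V | Dom r z /\ enorm (cproj isLX (z - q)) <= rho0] `&`
  [set z | enorm (cproj isY (z - q) - T z *: w) <= 0].
have K1c : closed K1.
  apply: closed_sublevel Kc _ => p _; apply: continuous_enorm_comp.
  apply: continuous_sub_at; first by apply: (cP _ id); exact: cvg_id.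
  by apply: continuous_scalec_at; exact: cT.
pose K2 := K1 `&` [set z | enorm (cproj isLX (F z - F q) - T z *: tau) <= 0].
have K2c : closed K2.
  apply: closed_sublevel K1c _ => p [[Dp _] _]; apply: continuous_enorm_comp.
  apply: continuous_sub_at; first by apply: (cP _ F); exact: cF.
  by apply: continuous_scalec_at; exact: cT.
pose K3 := K2 `&` [set z | enorm (cproj isY (F z - 0)) <= r].
have K3c : closed K3.
  apply: closed_sublevel K2c _ => p [[[Dp _] _] _]; apply: continuous_enorm_comp.
  by apply: (cP _ F); exact: cF.
pose K4 := K3 `&` [set z | T z <= 1].
have K4c : closed K4 by apply: closed_sublevel K3c _ => p _; exact: cT.
pose K5 := K4 `&` [set z | - 1 * T z <= 0].
have K5c : closed K5.
  by apply: closed_sublevel K4c _ => p _; apply: continuous_mulrc_at; exact: cT.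
have KP t z : 0 <= t <= 1 -> on_path t z -> K5 z /\ T z = t.
  move=> /andP[t0 t1] [Dz EY ELX e FY]; have Tz := T_path EY.
  split=> //; split; last by rewrite /= Tz mulN1r oppr_le0.
  split; last by rewrite /= Tz.
  split; last by rewrite /= subr0.
  split; last by rewrite /= ELX Tz subrr enorm0.
  by split=> //=; rewrite EY Tz subrr enorm0.
have PK z : K5 z -> 0 <= T z <= 1 /\ on_path (T z) z.
  move=> [[[[[[Dz e] /= EY] /= ELX] /= FY] /= T1] /= T0].
  have eq0 (x y : V) : enorm (x - y) <= 0 -> x = y.
    move=> h; apply/eqP; rewrite -subr_eq0; apply/eqP/enorm_eq0/eqP.
    by rewrite eq_le h enorm_ge0.
  split; first by rewrite T1 andbT; move: T0; rewrite mulN1r oppr_le0.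
  by split; rewrite ?(eq0 _ _ EY) ?(eq0 _ _ ELX)//; rewrite subr0 in FY.
have cK : compact K5.
  apply: (@closed_bounded_compact _ _ _ (enorm q + rho0 + enorm w)) => // z.
  move=> /PK [/andP[t0 t1] [_ EY _ e _]].
  rewrite -(subrK q z) addrC (le_trans (enormD _ _))// -addrA lerD2l.
  rewrite (le_trans (enorm_LX_Y _))// lerD// EY enormZ ger0_norm//.
  by rewrite ler_piMl// enorm_ge0.
have K0 : K5 !=set0.
  exists q; have [] // := KP 0 q; first by rewrite lexx ler01.
  split=> //; rewrite ?subrr ?cproj0 ?scale0r ?enorm0//; last by case: DFq.
  by rewrite mulr_ge0 ?invr_ge0 ?enorm_ge0// ltW.
have cT' : {within K5, continuous T} by exact: continuous_subspaceT.
have [z /set_mem Kz zmax] := compact_EVT_max K0 cK cT'.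
have [/andP[Tz0 Tz1] Pz] := PK _ Kz.
have Tz : T z = 1.
  apply/eqP; rewrite eq_le Tz1 leNgt; apply/negP => Tz_lt.
  have [|t' /andP[tt' t'1] [z' Pz']] := path_step _ Pz; first by rewrite Tz0.
  have [|Kz' Tz'] := KP t' z' _ Pz'; first by rewrite t'1 andbT (le_trans Tz0)// ltW.
  by have := zmax z' (mem_set Kz'); rewrite Tz' leNgt tt'.
have [Dz EY ELX e FY] := Pz; exists z; split=> //.
  by apply/eqP; rewrite -subr_eq0 cprojD opprD addrA -cprojB EY Tz scale1r subrr.
by apply/eqP; rewrite -subr_eq0 opprD addrA -cprojB ELX Tz scale1r subrr.
Qed.

(** The images of q + v and of the end z agree in (lambda, x) up to a translation, hence lie in each
    other's stable cone whatever their y-parts. Backwards, q + v and z have equal y, so the cone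
    leaves only a translation between them; both lambda-differences from q are below 1/2, so it is
    0. *)
Lemma no_wrap : cproj isLX (F (q + v) - F q) = tau.
Proof.
have [z [Dz Yz LXz e FY]] := path_end.
have Xtau : cproj isX (F (q + v)) = cproj isX (F q) + cproj isX tau.
  have := cprojX_shift tau_shift.
  rewrite cproj_sub_id; last exact: isX_isLX.
  by rewrite cprojB => <-; rewrite (addrC (cproj isX (F q))) subrK.
have DFz : Dom r (F z).
  split=> //; rewrite -(@cproj_sub_id _ _ _ _ isX isLX); last exact: isX_isLX.
  rewrite LXz cprojD cproj_sub_id; last exact: isX_isLX.
  by rewrite -Xtau; case: DFa.
have LXd : cproj isLX (F (q + v) - F z) = cproj isLX (F (q + v) - F q) - tau.
  by rewrite !cprojB LXz opprD addrA.
have J1 : Js (F z) L^-1 (F (q + v)).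
  rewrite /Js /=; have := tdist_le isLX (F (q + v) - F z) (shiftsN tau_shift).
  rewrite cprojB LXd (cprojB _ (cproj _ _)) cprojK LXtau subrr enorm0 => /le_trans; apply.
  by rewrite mulr_ge0 ?invr_ge0 ?enorm_ge0// ltW.
have Yaz : cproj isY (q + v - z) = 0 by rewrite (cprojB _ (q + v)) Yz subrr.
have := F_backward Da Dz DFa DFz J1; rewrite /Js /= Yaz enorm0 mulr0.
have [m [hm _ ->]] := tdist_attained isLX (q + v - z) => h.
have E0 : q + v - z + m = 0.
  rewrite (cproj_LX_Y (q + v - z + m)) [X in _ + X]cprojD Yaz add0r.
  rewrite (cproj_shifts hm) ?addr0; last by move=> i; exact: isY_isL.
  by apply/enorm_eq0/eqP; rewrite eq_le h enorm_ge0.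
have Ez' : z = q + v + m by apply/eqP; rewrite eq_sym -subr_eq0 addrAC E0.
have Ez : z - q = v + m by rewrite {1}Ez' -(addrA q) (addrC q) addrK.
have m_0 : m = 0.
  apply: (shifts_small (v := v) hm); last by rewrite -Ez; exact: small_lambda.
  apply: le_lt_trans rho0_lt; apply: le_trans cone.
  by apply: enorm_cproj_sub; exact: isL_isLX.
have -> : q + v = z by rewrite -(subrK q z) Ez m_0 addr0 addrC.
by rewrite cprojB LXz addrC addKr.
Qed.

End Path.
End Continuation.

(** * Growth rates and slopes of real sequences *)

Section RealSequences.
Variable R : realType.

Lemma expr_small (A t e : R) : 0 <= t < 1 -> 0 < e ->
  exists n0, forall n, (n0 <= n)%N -> A * t ^+ n < e.
Proof.
move=> /andP[t0 t1] e0; have A1 : 0 < `|A| + 1 by rewrite ltr_wpDl.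
have tn : `|t| < 1 by rewrite ger0_norm.
have /cvgrPdist_lt /(_ _ (divr_gt0 e0 A1)) [n0 _ H] := cvg_expr tn.
exists n0 => n /H /=; rewrite sub0r normrN ger0_norm ?exprn_ge0// ltr_pdivlMr//.
apply: le_lt_trans; rewrite mulrC ler_wpM2l ?exprn_ge0//.
by rewrite (le_trans (ler_norm _))// lerDl.
Qed.

Lemma growth_contradiction (e : nat -> R) (xi mu A : R) (n0 : nat) :
  0 <= mu -> mu < xi -> (forall n, e n <= A * mu ^+ n) ->
  (forall n, (n0 <= n)%N -> xi * e n <= e n.+1) -> 0 < e n0 -> False.
Proof.
move=> mu0 muxi eA ex e0; have xi0 : 0 < xi by exact: le_lt_trans muxi.
have H j : xi ^+ j * e n0 <= e (n0 + j)%N.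
  elim: j => [|j IH]; first by rewrite expr0 mul1r addn0.
  rewrite addnS; apply: le_trans (ex _ (leq_addr _ _)).
  by rewrite exprS -mulrA ler_wpM2l ?(ltW xi0).
have t01 : 0 <= mu / xi < 1.
  by rewrite divr_ge0 ?(ltW xi0)//= ltr_pdivrMr// mul1r.
have [j0 Hj] := expr_small (A * mu ^+ n0) t01 e0.
have := Hj _ (leqnn j0); rewrite ltNge => /negP; apply.
rewrite expr_div_n mulrA ler_pdivlMr ?exprn_gt0// mulrC.
by rewrite (le_trans (H _))// (le_trans (eA _))// exprD mulrA.
Qed.

(** The quadratic bounds from below the drop x e' - y' per unit of e. After multiplication by n - l,
    its excess over the chord is b (x - l)(n - x)(n - l) >= 0. *)
Lemma concave_bound (x l n m b a1 a2 d : R) : 0 <= b -> l <= x -> x <= n ->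
  d <= l * (m - b * l) - (a1 * l + a2) -> d <= n * (m - b * n) - (a1 * n + a2) ->
  d <= x * (m - b * x) - (a1 * x + a2).
Proof.
move=> b0 lx xn hl hn; have [ln|nl] := ltP l n; last first.
  by have -> : x = n by apply/eqP; rewrite eq_le xn (le_trans nl).
have nl0 : 0 < n - l by rewrite subr_gt0.
rewrite -(ler_pM2l nl0).
have h1 : 0 <= n - x by rewrite subr_ge0.
have h2 : 0 <= x - l by rewrite subr_ge0.
have h3 := ler_wpM2l h1 hl; have h4 := ler_wpM2l h2 hn.
have h5 : 0 <= b * ((x - l) * (n - x) * (n - l)) by rewrite !mulr_ge0// ltW.
lra.
Qed.

(* The slope y/e evolves in [l, n]; both end points are mapped strictly below
   themselves, hence so is every slope in between by concavity. *)
Lemma slope_step (l n m b mu1 mu2 k : R) : 0 < l -> l <= n -> 0 <= b -> 0 <= mu2 ->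
  0 < k -> mu1 < m - l * b -> mu2 < m - n * b ->
  exists2 d : R, 0 < d & forall x e y e' y' a1 a2 : R,
    0 < e -> l * e <= y -> y <= x * e -> x <= n -> 0 <= a1 ->
    a1 + l^-1 * a2 <= mu1 -> a1 + n^-1 * a2 <= mu2 ->
    y' <= a1 * y + a2 * e -> m * e - b * y <= e' -> e' <= k * (e + y) ->
    0 < e' /\ y' <= (x - d) * e'.
Proof.
move=> l0 ln b_ge0 mu2_ge0 k0 rate1 rate2; have n0 := lt_le_trans l0 ln.
(* At x = l one has a1 l + a2 = l (a1 + a2/l) <= l mu1, and similarly at n; so g is a drop at both
   ends, uniform in a1 and a2. *)
pose g := Num.min (l * (m - l * b - mu1)) (n * (m - n * b - mu2)).
have g0 : 0 < g by rewrite lt_min !mulr_gt0 ?subr_gt0.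
have kn : 0 < k * (1 + n) by rewrite mulr_gt0// addr_gt0.
(* e' <= k (e + y) <= k (1 + n) e turns the drop g e into a multiple of e'. *)
exists (g / (k * (1 + n))); first exact: divr_gt0.
move=> x e y e' y' a1 a2 e0 ly yx xn a1_ge0 h1 h2 hy he hk.
have lx : l <= x by rewrite -(ler_pM2r e0) (le_trans ly).
have x0 : 0 < x := lt_le_trans l0 lx.
have e1 : (m - b * x) * e <= e' by have := ler_wpM2l b_ge0 yx; lra.
have e'0 : 0 < e'.
  apply: lt_le_trans e1; rewrite mulr_gt0//.
  by have := ler_wpM2l b_ge0 xn; lra.
split=> //.
have gap : g <= x * (m - b * x) - (a1 * x + a2).
  apply: (concave_bound b_ge0 lx xn).
    have : g <= l * (m - l * b - mu1) by rewrite ge_min lexx.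
    have := ler_wpM2l (ltW l0) h1; rewrite mulrDr mulVKf ?gt_eqF//; lra.
  have : g <= n * (m - n * b - mu2) by rewrite ge_min lexx orbT.
  have := ler_wpM2l (ltW n0) h2; rewrite mulrDr mulVKf ?gt_eqF//; lra.
have g1 : g / (k * (1 + n)) * e' <= g * e.
  rewrite mulrAC ler_pdivrMr// -mulrA ler_wpM2l ?(ltW g0)//.
  rewrite (le_trans hk)// (mulrC e) -mulrA ler_wpM2l ?(ltW k0)//.
  have := ler_wpM2r (ltW e0) xn; lra.
have h3 := ler_wpM2l a1_ge0 yx.
have h4 := ler_wpM2r (ltW e0) gap.
have h5 := ler_wpM2l (ltW x0) e1.
lra.
Qed.

(** After more than n/d steps the slope bound n - j d is negative, against y >= 0. *)
Lemma slope_descent (e y : nat -> R) (n d : R) : 0 < d -> (forall j, 0 <= y j) ->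
  0 < e 0%N -> y 0%N <= n * e 0%N ->
  (forall j x, 0 < e j -> y j <= x * e j -> x <= n ->
     0 < e j.+1 /\ y j.+1 <= (x - d) * e j.+1) -> False.
Proof.
move=> d0 y_ge0 e0 y0 step.
have all j : 0 < e j /\ y j <= (n - j%:R * d) * e j.
  elim: j => [|j [ej yj]]; first by rewrite mul0r subr0.
  have [|h1 h2] := step j _ ej yj; first by rewrite gerBl mulr_ge0// ltW.
  by split=> //; rewrite (le_trans h2)// -natr1 (mulrDl j%:R 1) mul1r opprD addrA.
have [] := all (Num.truncn (n / d)).+1; set j := _.+1 => ej yj.
have := y_ge0 j; rewrite leNgt => /negP; apply; apply: le_lt_trans yj _.
by rewrite nmulr_rlt0// subr_lt0 -ltr_pdivrMr// truncnS_gt.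
Qed.

End RealSequences.

(** * Pairs of orbits and the stable fiber *)

Section Dynamics.
Variables (R : realType) (c u s : nat).
Local Notation V := 'cV[R]_(c + u + s).
Variables (r L B : R) (U : set V) (F : V -> V).
Hypothesis r_gt0 : 0 < r.
Hypothesis L_gt0 : 0 < L.
Hypothesis r_L : 2 * r / L < 2^-1.
Hypothesis F_C1 : C1_on U F.
Hypothesis Dom_U : Dom r `<=` U.
Hypothesis Jac_le : forall p, Dom r p -> forall i j, `|Jac F p i j| <= B.
Hypothesis F_lift : is_lift r F.
Hypothesis F_cover : covering_conditions r L F.
Hypothesis F_backward : backward_cone_conditions r L F.
Hypothesis mu_s1_lt1 : mu_s1 r L F < 1.
Hypothesis rate : mu_s1 r L F < xi_cu1P r L F.

Let m0 := min_expansion r F.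
Let b0 := shear_bound r F.
Let dLX (p q : V) := tdist isLX (p - q).
Let dY (p q : V) := enorm (cproj isY (p - q)).
Let Li : 0 <= L^-1. Proof. by rewrite invr_ge0 ltW. Qed.

(** Iterates of given lifts need not stay close as vectors. At each time p is replaced by its lift q
    + v closest to q, and [is_lift] keeps the image unchanged on the torus. *)
Let closest_lift p q : Dom r p -> exists v, [/\ shifts (q + v - p), Dom r (q + v),
  shifts (F (q + v) - F p), dLX p q = enorm (cproj isLX v) &
  cproj isY v = cproj isY (p - q)].
Proof.
move=> Dp; have [m [hm _ E]] := tdist_attained isLX (p - q).
have Eqv : q + (p - q + m) = p + m by rewrite addrA (addrC q) subrK.
exists (p - q + m); rewrite Eqv; split => //.
- by rewrite addrC addKr.
- exact: Dom_shift.
- exact: F_lift.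
- rewrite cprojD (cproj_shifts hm) ?addr0// => i; exact: isY_isL.
Qed.

Let image_lift p q v : shifts (F (q + v) - F p) ->
  dLX (F p) (F q) = tdist isLX (F (q + v) - F q) /\
  dY (F p) (F q) = enorm (cproj isY (F (q + v) - F q)).
Proof.
move=> h; have h' : shifts (F (q + v) - F q - (F p - F q)).
  by rewrite opprB addrA subrK.
by rewrite /dLX /dY -(tdist_congr _ h') (cprojY_shift h').
Qed.

Let step_Y p q : Dom r p -> Dom r q -> exists a b : R, [/\ 0 <= a, 0 <= b,
    (forall k, 0 <= k -> a + k * b <=
       supD r (fun q => bnorm isY isY (Jac F q) + k * bnorm isY isLX (Jac F q))) &
    dY (F p) (F q) <= a * dY p q + b * dLX p q].
Proof.
move=> Dp Dq; have [v [_ Dqv hF -> Yv]] := closest_lift q Dp.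
have [a [b [a0 b_0 H E]]] := MVT_Y F_C1 Dom_U Jac_le Dq Dqv.
by exists a, b; split=> //; rewrite (image_lift hF).2 /dY -Yv.
Qed.

Let step_Y_cone p q : Dom r p -> Dom r q -> dLX p q <= L^-1 * dY p q ->
  dY (F p) (F q) <= mu_s1 r L F * dY p q.
Proof.
move=> Dp Dq; have [v [_ Dqv hF -> Yv]] := closest_lift q Dp.
rewrite (image_lift hF).2 /dY -Yv.
exact: contraction_Y L_gt0 F_C1 Dom_U Jac_le _ _ Dq Dqv.
Qed.

(** If the Lipschitz bound stays below 1/2, the image difference is itself a closest lift and
    [expansion] applies to the torus distance. *)
Let step_LX : exists2 C : R, 0 < C & forall p q, Dom r p -> Dom r q ->
  dLX (F p) (F q) <= C * (dLX p q + dY p q) /\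
  (dLX p q <= 2^-1 -> C * (dLX p q + dY p q) < 2^-1 ->
   m0 * dLX p q - b0 * dY p q <= dLX (F p) (F q)).
Proof.
have [C C0 HC] := lipschitz_Dom F_C1 Dom_U Jac_le; exists C => // p q Dp Dq.
have [v [_ Dqv hF E Yv]] := closest_lift q Dp.
rewrite (image_lift hF).1 /dY -Yv E.
have H : enorm (F (q + v) - F q) <= C * (enorm (cproj isLX v) + enorm (cproj isY v)).
  by rewrite (le_trans (HC _ _ Dq Dqv))// ler_wpM2l ?(ltW C0)// enorm_LX_Y.
split=> [|vL small].
  rewrite (le_trans (tdist_le0 _ _))// (le_trans (enorm_cproj _ _))//.
rewrite tdist_small => [|i _].
  apply: expansion F_C1 Dom_U Jac_le _ _ Dq Dqv _; apply: le_trans vL.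
  by apply: enorm_cproj_sub; exact: isL_isLX.
by rewrite (le_trans (abs_coord_enorm _ _))// (le_trans H)// ltW.
Qed.

Let dY_le p q : Dom r p -> Dom r q -> dY p q <= 2 * r.
Proof.
move=> [_ py] [_ qy]; rewrite /dY cprojB (le_trans (enormD _ _))// enormN.
by rewrite mulr_natl mulr2n lerD.
Qed.

(** Trades the smallness in [step_LX] for the cone bound at two consecutive times. The second
    iterate of q is required in D so that q has |x| < r, where the path starts. *)
Let step_expand p q : Dom r p -> Dom r q -> Dom r (F p) -> Dom r (F q) ->
  Dom r (F (F q)) -> dLX p q <= L^-1 * dY p q ->
  dLX (F p) (F q) <= L^-1 * dY (F p) (F q) ->
  m0 * dLX p q - b0 * dY p q <= dLX (F p) (F q).
Proof.
move=> Dp Dq DFp DFq DFFq cone cone'.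
have [y0|y0] := eqVneq (dY p q) 0.
  have e0 : dLX p q = 0 by apply/eqP; rewrite eq_le tdist_ge0 (le_trans cone)// y0 mulr0.
  by rewrite e0 y0 !mulr0 subrr tdist_ge0.
have yp : 0 < dY p q by rewrite lt_def y0 enorm_ge0.
have eh : dLX p q <= 2^-1.
  rewrite (le_trans cone)// ltW// (le_lt_trans _ r_L)// mulrC ler_wpM2r//.
  exact: dY_le.
have [v [hv Dqv hF E Yv]] := closest_lift q Dp.
have [E1 E2] := image_lift hF.
have [m [hm _ Em]] := tdist_attained isLX (F (q + v) - F q).
(* The closest representative of the image difference, a priori a translate of the plain one. *)
pose tau := cproj isLX (F (q + v) - F q + m).
have DFa : Dom r (F (q + v)) by rewrite -(subrK (F p) (F (q + v))) addrC; exact: Dom_shift.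
have -> : dLX (F p) (F q) = enorm tau by rewrite E1 Em.
have Etau : cproj isLX (F (q + v) - F q) = tau.
  apply: (no_wrap r_gt0 L_gt0 r_L F_C1 Dom_U Jac_le F_cover F_backward rate Dq Dqv DFq DFa).
  - exact: covering_strict_X r_gt0 F_C1 Dom_U Jac_le F_cover _ Dq DFq DFFq.
  - by rewrite -E Yv.
  - by rewrite Yv.
  - by rewrite cprojK.
  - have -> : cproj isLX (F (q + v) - F q) - tau = - m; last exact: shiftsN.
    rewrite /tau -cprojB opprD addrA subrr add0r cprojN; congr (- _).
    rewrite [RHS]cproj_LX_Y (@cproj_shifts _ _ _ _ isY _ hm) ?addr0// => i; exact: isY_isL.
  - by rewrite -E2 -Em -E1.
rewrite -Etau E /dY -Yv; apply: expansion F_C1 Dom_U Jac_le _ _ Dq Dqv _.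
apply: le_trans eh; rewrite E.
by apply: enorm_cproj_sub; exact: isL_isLX.
Qed.

Let mu_ge0 : 0 <= mu_s1 r L F.
Proof. exact: mu_s1_ge0 r_gt0 L_gt0 F_C1 Dom_U Jac_le. Qed.

Section Fiber.
Variables (z p q : V).
Hypothesis zW : Wcs r F z.
Hypothesis pW : Ws r L F z p.
Hypothesis qW : Ws r L F z q.
Let pn n := iter n F p.
Let qn n := iter n F q.
Let Dp n : Dom r (pn n). Proof. by have [_ /(_ n) []] := pW. Qed.
Let Dq n : Dom r (qn n). Proof. by have [_ /(_ n) []] := qW. Qed.
Let e n := dLX (pn n) (qn n).
Let y n := dY (pn n) (qn n).

(** By definition the fiber is in the cone of the orbit of z only, so p and q are compared through
    that orbit. *)
Let dY_base x n : Ws r L F z x ->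
  dY (iter n F x) (iter n F z) <= 2 * r * mu_s1 r L F ^+ n.
Proof.
move=> [_ xW]; elim: n => [|n IH].
  by rewrite expr0 mulr1; apply: dY_le; [have [] := xW 0%N|exact: (zW 0%N)].
have [J D] := xW n; rewrite !iterS (le_trans (step_Y_cone D (zW n) J))//.
by rewrite exprS mulrCA ler_wpM2l.
Qed.

Let difference n : pn n - qn n =
  (iter n F p - iter n F z) - (iter n F q - iter n F z).
Proof. by rewrite opprB addrA subrK. Qed.

Let y_small n : y n <= 4 * r * mu_s1 r L F ^+ n.
Proof.
have h1 := dY_base n pW; have h2 := dY_base n qW.
rewrite /y /dY difference cprojB (le_trans (enormD _ _))// enormN.
rewrite (le_trans (lerD h1 h2))// -mulrDl.
by rewrite (_ : 2 * r + 2 * r = 4 * r)//; ring.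
Qed.

Let e_small n : e n <= (L^-1 * (4 * r)) * mu_s1 r L F ^+ n.
Proof.
have h1 := ler_wpM2l Li (dY_base n pW); have h2 := ler_wpM2l Li (dY_base n qW).
have [_ /(_ n) [J1 _]] := pW; have [_ /(_ n) [J2 _]] := qW.
have h3 := le_trans J1 h1; have h4 := le_trans J2 h2.
rewrite /e /dLX difference (le_trans (tdistD _ _ _))// tdistN.
rewrite (le_trans (lerD h3 h4))// -mulrDr -mulrDl -mulrA.
by rewrite (_ : 2 * r + 2 * r = 4 * r)//; ring.
Qed.

(* Outside the cone, points stay outside by the backward cone condition; then
   the (lambda, x)-distance decays slower than mu_{s,1}^n, while both orbits
   approach the base orbit at that rate. *)
Lemma fiber_cone n : e n <= L^-1 * y n.
Proof.
rewrite leNgt; apply/negP => esc.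
have {}esc j : (n <= j)%N -> L^-1 * y j < e j.
  move=> /subnK <-; elim: (j - n)%N => [//|k IH].
  rewrite ltNge; apply/negP => h; move: IH; rewrite ltNge => /negP; apply.
  exact: F_backward (Dp _) (Dq _) (Dp (k + n).+1) (Dq (k + n).+1) h.
have [C C0 HC] := step_LX.
have mu01 : 0 <= mu_s1 r L F < 1 by rewrite mu_ge0.
have C2 : 0 < (2 * C)^-1 / 2 :> R by rewrite divr_gt0// invr_gt0 mulr_gt0.
(* n1 and n2 are the times from which the two smallness assumptions of [step_LX] hold. *)
have [n1 H1] := expr_small (C * (L^-1 * (4 * r) + 4 * r)) mu01 (e := 2^-1) ltac:(by rewrite invr_gt0).
have [n2 H2] := expr_small (L^-1 * (4 * r)) mu01 (e := 2^-1) ltac:(by rewrite invr_gt0).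
pose k := maxn n (maxn n1 n2).
apply: (@growth_contradiction R e (xi_cu1P r L F) (mu_s1 r L F) (L^-1 * (4 * r)) k) => //.
  move=> j; rewrite !geq_max => /and3P[nj n1j n2j].
  have [_ H] := HC _ _ (Dp j) (Dq j).
  apply: le_trans (H _ _).
  (* Outside the cone y < L e, so m0 e - b0 y >= (m0 - L b0) e. *)
  - have := esc _ nj; rewrite mulrC ltr_pdivrMr// => h.
    have b0_ge0 : 0 <= b0 := shear_bound_ge0 Jac_le (ltW r_gt0).
    have := ler_wpM2l b0_ge0 (ltW h).
    have -> : xi_cu1P r L F = m0 - L * b0 by [].
    rewrite -/(e j) -/(y j); lra.
  - exact: (le_trans (e_small j) (ltW (H2 _ n2j))).
  - apply: le_lt_trans (H1 _ n1j); rewrite -mulrA ler_wpM2l ?(ltW C0)// mulrDl.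
    by rewrite lerD// ?y_small ?e_small.
by apply: le_lt_trans (esc k (leq_maxl _ _)); rewrite mulr_ge0// enorm_ge0.
Qed.

Variable M : R.
Hypothesis M_gt0 : 0 < M.
Hypothesis M_lt : M < L^-1.
Let mu := supD r (fun x => bnorm isY isY (Jac F x) + M * bnorm isY isLX (Jac F x)).
Hypothesis mu_xi : mu < m0 - M^-1 * b0.

Lemma fiber_lipschitz : tdist isLX (p - q) <= M * enorm (cproj isY (p - q)).
Proof.
rewrite leNgt; apply/negP => bad.
have b0_ge0 : 0 <= b0 := shear_bound_ge0 Jac_le (ltW r_gt0).
have [C C0 HC] := step_LX.
have LN : L <= M^-1 by rewrite -(invrK L) lef_pV2 ?posrE ?invr_gt0// ltW.
have mu0 : 0 <= mu.
  have [a [b [a0 b_0 H _]]] := step_Y (Dp 0) (Dq 0).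
  by apply: le_trans (H _ (ltW M_gt0)); rewrite addr_ge0// mulr_ge0// ltW.
(* Slopes y/e range from L, by the cone bound, to 1/M, by the assumption to be refuted. *)
have [delta delta0 step] := slope_step L_gt0 LN b0_ge0 mu0 C0 rate mu_xi.
apply: (@slope_descent R e y M^-1 delta delta0).
- by move=> n; exact: enorm_ge0.
- by apply: le_lt_trans bad; rewrite mulr_ge0 ?enorm_ge0// ltW.
- by rewrite mulrC ler_pdivlMr// mulrC; exact: ltW.
move=> n x en yx xN.
have [a [b [a0 b_0 H Ey]]] := step_Y (Dp n) (Dq n).
apply: (step x (e n) (y n) _ _ a b en _ yx xN a0 _ _ Ey).
- by have := fiber_cone n; rewrite mulrC ler_pdivlMr// mulrC.
- exact: H.
- by rewrite invrK; apply: H; exact: ltW.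
- exact: (step_expand (Dp n) (Dq n) (Dp n.+1) (Dq n.+1) (Dq n.+2)
    (fiber_cone n) (fiber_cone n.+1)).
- by have [] := HC _ _ (Dp n) (Dq n).
Qed.

End Fiber.
End Dynamics.

(** The Lipschitz bound is stated for pairs of points of the fiber: for points (w(y1), y1) and
    (w(y2), y2) of its graph it reads |w(y1) - w(y2)| <= M |y1 - y2|, with the distance on the torus
    since lifts are arbitrary. *)
Theorem theorem3p2 (R : realType) (c u s k : nat) (R0 L M : R)
    (F : 'cV[R]_(c + u + s) -> 'cV[R]_(c + u + s)) :
  (0 < c)%N -> (0 < u)%N -> (0 < s)%N -> (1 <= k)%N ->
  0 < R0 -> R0 < RL / 2 ->
  2 * R0 / RL < L -> L < 1 ->
  (* f is C^(k+1) (on an open neighbourhood of D) and F is a lift of f *)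
  (exists U : set 'cV[R]_(c + u + s), open U /\ Dom R0 `<=` U /\ Ck k.+1 U F) ->
  is_lift R0 F ->
  covering_conditions R0 L F ->
  rate_conditions k R0 L F ->
  backward_cone_conditions R0 L F ->
  0 < M -> M < L^-1 ->
  let mu := supD R0 (fun p => bnorm isY isY (Jac F p) + M * bnorm isY isLX (Jac F p)) in
  let xi := infD R0 (fun z => bmI F isLX isLX (Pset R0 z))
            - M^-1 * supD R0 (fun p => bnorm isLX isY (Jac F p)) in
  1 < xi / mu ->
  forall z, Wcs R0 F z ->
  forall p1 p2, Ws R0 L F z p1 -> Ws R0 L F z p2 ->
    tdist isLX (p1 - p2) <= M * enorm (cproj isY (p1 - p2)).
Proof.
move=> _ _ _ _ R0_gt0 _ R0_L _ [U [oU [DU FC]]] F_lift F_cover.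
move=> [_ [[mu_s1_lt1 [_ [_ rate]]] _]] F_back M_gt0 M_lt mu xi ratio z zW p1 p2 W1 W2.
have L_gt0 : 0 < L.
  by apply: le_lt_trans R0_L; rewrite !mulr_ge0 ?invr_ge0 ?invr_ge0 ?(ltW R0_gt0).
have r_L : 2 * R0 / L < 2^-1.
  by move: R0_L; rewrite /RL invrK ltr_pdivrMr// => h; lra.
have F_C1 := Ck_C1 oU FC.
have [B _ Jac_le] := Jac_bounded R0_gt0 F_C1 DU F_lift.
have mu_ge0 : 0 <= mu.
  have D0 : Dom R0 (0 : 'cV[R]_(c + u + s)) by split; rewrite cproj0 enorm0 ltW.
  have [|a [b [a0 b0 H _]]] := MVT_Y F_C1 DU Jac_le D0 (v := 0); first by rewrite addr0.
  by apply: le_trans (H _ (ltW M_gt0)); rewrite addr_ge0// mulr_ge0// ltW.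
have mu_xi : mu < xi.
  (* Division by 0 yields 0, so the assumption on the ratio excludes mu = 0. *)
  move: ratio; have [->|mu0] := eqVneq mu 0; first by rewrite invr0 mulr0 ltr10.
  by rewrite ltr_pdivlMr ?mul1r// lt_def mu0.
exact: (fiber_lipschitz R0_gt0 L_gt0 r_L F_C1 DU Jac_le F_lift F_cover F_back
  mu_s1_lt1 rate zW W1 W2 M_gt0 M_lt mu_xi).
Qed.
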